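(* There exists a residually nilpotent finitely generated group $H$ with solvable word problem but uncomputable nilpotent quotients: no algorithm can, on input $n$, produce a finite presentation of $H/\gamma_n(H)$. Moreover, this group can be supposed central-by-metabelian.
   Context: $\gamma_1(H)=H$ and $\gamma_{n+1}(H)=[\gamma_n(H),H]$ is the lower central series. Finite presentations of $H/\gamma_n(H)$ are understood with respect to the images of a fixed finite generating tuple of $H$. A group is central-by-metabelian if its quotient by its centre is metabelian. *)

(* Defs.v *)
From HB Require Import structures.
From mathcomp Require Import all_boot.
From mathcomp Require Import boolp classical_sets.

Set Implicit Arguments.
Unset Strict Implicit.
Unset Printing Implicit Defensive.

Local Open Scope classical_set_scope.
Local Open Scope quotient_scope.
Local Open Scope group_scope.

Definition subgroup (G : groupType) (A : set G) : Prop :=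
  [/\ A 1, (forall x y, A x -> A y -> A (x * y)) & (forall x, A x -> A x^-1)].

Definition generated (G : groupType) (S : set G) : set G :=
  smallest (@subgroup G) S.

Record normalSubgroup (G : groupType) := NormalSubgroup {
  normal_set : set G;
  normal_group : subgroup normal_set;
  normal_conj : forall x y : G, normal_set x -> normal_set (x ^ y)
}.

Section Quotient.
Variables (G : groupType) (N : normalSubgroup G).
Implicit Types x y z : G.

Lemma normal1 : normal_set N 1.
Proof. by have [] := normal_group N. Qed.

Lemma normalV x : normal_set N x -> normal_set N x^-1.
Proof. by have [_ _ NV] := normal_group N; apply: NV. Qed.

Lemma normalM x y :
  normal_set N x -> normal_set N y -> normal_set N (x * y).
Proof. by have [_ NM _] := normal_group N; apply: NM. Qed.

Definition coset_rel x y : bool := x^-1 * y \in normal_set N.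

Lemma coset_rel_refl : reflexive coset_rel.
Proof. by move=> x; rewrite /coset_rel mulVg; apply/mem_set/normal1. Qed.

Lemma coset_rel_sym : symmetric coset_rel.
Proof.
suff imp x y : coset_rel x y -> coset_rel y x by move=> x y; apply/idP/idP; apply: imp.
by move=> /set_mem /normalV; rewrite invgM invgK => /mem_set.
Qed.

Lemma coset_rel_trans : transitive coset_rel.
Proof.
move=> y x z /set_mem Nxy /set_mem Nyz; apply/mem_set.
by have := normalM Nxy Nyz; rewrite mulgA mulgK.
Qed.

Canonical coset_equiv :=
  EquivRel coset_rel coset_rel_refl coset_rel_sym coset_rel_trans.

Definition quot : Type := {eq_quot coset_equiv}.

HB.instance Definition _ := EqQuotient.on quot.
HB.instance Definition _ := Choice.on quot.

Definition quot_pi : G -> quot := \pi_quot.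

Lemma quot_piP x y : quot_pi x = quot_pi y <-> normal_set N (x^-1 * y).
Proof.
split=> [/eqmodP /set_mem //|Nxy]; apply/eqmodP; exact: mem_set.
Qed.

Definition quot_one : quot := quot_pi 1.
Definition quot_inv (a : quot) : quot := quot_pi (repr a)^-1.
Definition quot_mul (a b : quot) : quot := quot_pi (repr a * repr b).

Lemma quot_piK (a : quot) : quot_pi (repr a) = a.
Proof. exact: reprK. Qed.

Lemma quot_mulE x y : quot_mul (quot_pi x) (quot_pi y) = quot_pi (x * y).
Proof.
apply/quot_piP; set x' := repr _; set y' := repr _.
have /quot_piP Nx : quot_pi x' = quot_pi x by rewrite quot_piK.
have /quot_piP Ny : quot_pi y' = quot_pi y by rewrite quot_piK.
have -> : (x' * y')^-1 * (x * y) = (x'^-1 * x) ^ y' * (y'^-1 * y).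
  by rewrite /conjg invgM !mulgA mulgK.
exact/normalM/Ny/normal_conj.
Qed.

Lemma quot_invE x : quot_inv (quot_pi x) = quot_pi x^-1.
Proof.
apply/quot_piP; set x' := repr _.
have /quot_piP Nx : quot_pi x = quot_pi x' by rewrite quot_piK.
have -> : x'^-1^-1 * x^-1 = (x^-1 * x') ^ x^-1.
  by rewrite /conjg !invgK !mulgA mulgV mul1g.
exact: normal_conj.
Qed.

Lemma quot_mulA : associative quot_mul.
Proof.
move=> a b c; rewrite -(quot_piK a) -(quot_piK b) -(quot_piK c).
by rewrite !quot_mulE mulgA.
Qed.

Lemma quot_mul1 : left_id quot_one quot_mul.
Proof. by move=> a; rewrite -(quot_piK a) quot_mulE mul1g. Qed.

Lemma quot_mulr1 : right_id quot_one quot_mul.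
Proof. by move=> a; rewrite -(quot_piK a) quot_mulE mulg1. Qed.

Lemma quot_mulV : left_inverse quot_one quot_inv quot_mul.
Proof. by move=> a; rewrite -(quot_piK a) quot_invE quot_mulE mulVg. Qed.

Lemma quot_mulrV : right_inverse quot_one quot_inv quot_mul.
Proof. by move=> a; rewrite -(quot_piK a) quot_invE quot_mulE mulgV. Qed.

HB.instance Definition _ := isGroup.Build quot
  quot_mulA quot_mul1 quot_mulr1 quot_mulV quot_mulrV.

Lemma quot_piM : {morph quot_pi : x y / x * y}.
Proof. by move=> x y; rewrite -quot_mulE. Qed.

End Quotient.

Definition commutator_subgroup (G : groupType) (A B : set G) : set G :=
  generated [set c | exists x y, [/\ A x, B y & c = [~ x, y]]].

(* [lcs_set G 1] is [G]; the index 0 is junk and also gives [G]. *)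
Definition lcs_set (G : groupType) (n : nat) : set G :=
  iter n.-1 (fun A => commutator_subgroup A setT) setT.
Arguments lcs_set : clear implicits.

Lemma generated_group (G : groupType) (S : set G) : subgroup (generated S).
Proof.
split=> [A [[]] //|x y Sx Sy|x Sx] A [gA SA]; have [_ AM AV] := gA.
  by apply: AM; [apply: Sx | apply: Sy].
by apply: AV; apply: Sx.
Qed.

Lemma generated_conj (G : groupType) (S : set G) :
  (forall x y, S x -> S (x ^ y)) ->
  forall x y, generated S x -> generated S (x ^ y).
Proof.
move=> SJ x y Sx; have [g1 gM gV] := generated_group S.
apply: (Sx [set z | generated S (z ^ y)]); split=> [|z Sz] /=; last first.
  by apply: sub_gen_smallest; apply: SJ.
split=> [|u v Su Sv|u Su] /=.
- by rewrite conj1g.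
- by rewrite conjMg; apply: gM.
- by rewrite conjVg; apply: gV.
Qed.

Lemma lcs_conj (G : groupType) (n : nat) (x y : G) :
  lcs_set G n x -> lcs_set G n (x ^ y).
Proof.
rewrite /lcs_set; elim: n.-1 x y => [//|m IHm] /=; apply: generated_conj.
move=> _ z [a] [b] [Aa _ ->]; exists (a ^ z), (b ^ z); split=> //; first exact: IHm.
by rewrite conjRg.
Qed.

Lemma lcs_group (G : groupType) (n : nat) : subgroup (lcs_set G n).
Proof.
rewrite /lcs_set; case: n.-1 => [|m]; last exact: generated_group.
by [].
Qed.

Definition lcs (G : groupType) (n : nat) : normalSubgroup G :=
  NormalSubgroup (@lcs_group G n) (@lcs_conj G n).

Definition center_set (G : groupType) : set G :=
  [set z | forall x, commute z x].

Lemma center_group (G : groupType) : subgroup (@center_set G).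
Proof.
split=> [x|u v Zu Zv x|u Zu x]; apply/commute_sym.
- exact: commute1.
- by apply: commuteM; apply/commute_sym.
- exact/commuteV/commute_sym.
Qed.

Lemma center_conj (G : groupType) (x y : G) :
  center_set x -> center_set (x ^ y).
Proof. by move=> Zx; rewrite /conjg (Zx y) mulgA mulVg mul1g. Qed.

Definition center (G : groupType) : normalSubgroup G :=
  NormalSubgroup (@center_group G) (@center_conj G).

Definition nilpotent_group (G : groupType) : Prop :=
  exists n : nat, lcs_set G n = [set 1].

Definition residually_nilpotent (G : groupType) : Prop :=
  forall x : G, x <> 1 ->
  exists N : normalSubgroup G, ~ normal_set N x /\ nilpotent_group (quot N).

Definition metabelian (G : groupType) : Prop :=
  let G' := commutator_subgroup [set: G] [set: G] in
  forall x y : G, G' x -> G' y -> commute x y.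

Definition central_by_metabelian (G : groupType) : Prop :=
  metabelian (quot (center G)).

(* The letter [(i, false)] is the i-th generator, [(i, true)] its inverse. *)
Definition word (k : nat) : Type := seq ('I_k * bool).

Definition word_value (G : groupType) (k : nat) (g : k.-tuple G) (w : word k) : G :=
  \prod_(a <- w) (if a.2 then (tnth g a.1)^-1 else tnth g a.1).

Definition generates (G : groupType) (k : nat) (g : k.-tuple G) : Prop :=
  generated [set x | x \in g] = setT.

(* Equality of words in the group given by generators 'I_k and relators R. *)
Inductive pres_eq (k : nat) (R : seq (word k)) : word k -> word k -> Prop :=
| pres_refl u : pres_eq R u u
| pres_sym u v : pres_eq R u v -> pres_eq R v u
| pres_trans u v w : pres_eq R u v -> pres_eq R v w -> pres_eq R u w
| pres_cat u u' v v' :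
    pres_eq R u u' -> pres_eq R v v' -> pres_eq R (u ++ v) (u' ++ v')
| pres_cancel i b : pres_eq R [:: (i, b); (i, ~~ b)] [::]
| pres_relator r : r \in R -> pres_eq R r [::].

(* The i-th generator |-> g_i induces an isomorphism onto G from the group
   given by the generators 'I_k and the relators R. *)
Definition presents (k : nat) (R : seq (word k)) (G : groupType) (g : k.-tuple G) :
    Prop :=
  generates g /\
  forall u v : word k, pres_eq R u v <-> word_value g u = word_value g v.

(* The Cantor pairing, a bijection nat * nat -> nat. *)
Definition cpair (m n : nat) : nat := 'C((m + n).+1, 2) + n.

(* The partial recursive functions, as unary functions on nat, several
   arguments being passed through [cpair]. [pr_eval c x y] means that the
   function [c] is defined at [x] with value [y]. *)
Inductive partrec : Type :=
| PZero | PSucc | PLeft | PRight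
| PPair of partrec & partrec
| PComp of partrec & partrec
| PRec of partrec & partrec
| PMu of partrec.

Inductive pr_eval : partrec -> nat -> nat -> Prop :=
| eval_zero x : pr_eval PZero x 0
| eval_succ x : pr_eval PSucc x x.+1
| eval_left m n : pr_eval PLeft (cpair m n) m
| eval_right m n : pr_eval PRight (cpair m n) n
| eval_pair f g x y z :
    pr_eval f x y -> pr_eval g x z -> pr_eval (PPair f g) x (cpair y z)
| eval_comp f g x y z :
    pr_eval g x y -> pr_eval f y z -> pr_eval (PComp f g) x z
| eval_rec0 f g x y :
    pr_eval f x y -> pr_eval (PRec f g) (cpair x 0) y
| eval_recS f g x n y z :
    pr_eval (PRec f g) (cpair x n) y ->
    pr_eval g (cpair x (cpair n y)) z ->
    pr_eval (PRec f g) (cpair x n.+1) z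
| eval_mu f x n (v : nat -> nat) :
    (forall m, m < n -> pr_eval f (cpair x m) (v m).+1) ->
    pr_eval f (cpair x n) 0 ->
    pr_eval (PMu f) x n.

Definition encode_seq (s : seq nat) : nat :=
  foldr (fun x c => (cpair x c).+1) 0 s.

Definition encode_word (k : nat) (w : word k) : nat :=
  encode_seq [seq a.1.*2 + a.2 | a : 'I_k * bool <- w].

Definition encode_words (k : nat) (R : seq (word k)) : nat :=
  encode_seq [seq encode_word w | w <- R].

Definition solvable_word_problem (G : groupType) (k : nat) (g : k.-tuple G) : Prop :=
  exists c : partrec, forall w : word k,
    pr_eval c (encode_word w) (word_value g w == 1).

Definition computable_nilpotent_quotients
    (G : groupType) (k : nat) (g : k.-tuple G) : Prop :=
  exists c : partrec, forall n : nat, 0 < n ->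
    exists2 R : seq (word k),
      pr_eval c n (encode_words R) &
      presents R [tuple of map (@quot_pi G (lcs G n)) g].

(* Main.v *)
(* For Q : Z -> F_2 with Q 0 = 0, let a and t act on the vectors (phi, c, r),
   with phi : Z -> F_2 and c, r in F_2, by

     a (phi, c, r) = (phi + r Q, c + phi 0, r),
     t (phi, c, r) = (phi(. + 1), c, r).

   Modulo its centre the group they generate is a quotient of the lamplighter
   group, and the commutator of a^(t^m) and a adds r (Q m + Q (- m)) to c. For a
   set A of naturals let Q be the indicator of the (4 j + 1) 2^k with k in A.
   If A is finite then Q has period some 2^K, and on phi of that period the
   action is unipotent, because the difference operator D satisfies
   D^(2^K) phi = phi + phi(. + 2^K) = 0. The same Frobenius identity shows that
   the central element z_k = [a^(t^(2^k)), a], which is trivial exactly when k is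
   not in A, lies in the (2^k + 2)-nd term of the lower central series as soon as
   k + 1 is not in A.

   The group H acts by a and t on all e at once, with sets A_e: 4 e is in A_e,
   and 4 <e, s> + 2 is in A_e when the program e, run on n_e = 2^(4 e + 2) + 2,
   stops at step s with relators that all act trivially for A = {4 e} and period
   2^(4 e + 2). A word of length L only sees finitely many e and k, whence a
   solution of the word problem. If the program e computed the nilpotent
   quotients, the relators it finds on n_e would act trivially for A = {4 e}:
   otherwise A_e = {4 e} and that action factors through the n_e-th quotient. But
   then z_(4e) = z_(4<e,s>+2) is in the n_e-th term, hence is a consequence of
   these relators, although it acts nontrivially for A = {4 e}. *)

Require Import Defs.
From HB Require Import structures.
From mathcomp Require Import all_boot all_algebra zify.
From mathcomp Require Import boolp classical_sets.

Set Implicit Arguments.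
Unset Strict Implicit.
Unset Printing Implicit Defensive.

Import GRing.Theory Num.Theory.
Local Open Scope classical_set_scope.

(** * Computable functions *)

(** The successor along the antidiagonals in the numbering by [cpair]; iterating it from [(0, 0)]
    therefore inverts [cpair]. *)
Definition cnext (p : nat * nat) : nat * nat :=
  if p.1 is m.+1 then (m, p.2.+1) else (p.2.+1, 0).

Definition cunpair (z : nat) : nat * nat := iter z cnext (0, 0).
Definition cfst z := (cunpair z).1.
Definition csnd z := (cunpair z).2.

Lemma cpair_next p : cpair (cnext p).1 (cnext p).2 = (cpair p.1 p.2).+1.
Proof.
rewrite /cpair; case: p => [[|m] n]; simpl fst; simpl snd.
  by rewrite !addn0 add0n [in LHS]binS bin1; lia.
by rewrite addnS [m.+1 + n]addSn addnS.
Qed.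

Lemma cunpairK z : cpair (cfst z) (csnd z) = z.
Proof.
rewrite /cfst /csnd; elim: z => [|z IHz] //.
by rewrite [cunpair _]/= cpair_next -/(cunpair z) IHz.
Qed.

Lemma leq_cpair m n : m + n <= cpair m n.
Proof.
rewrite /cpair binS bin1; suff: 0 <= 'C(m + n, 2) by lia.
by [].
Qed.

(** Induction on the code: each pair other than [(0, 0)] is [cnext] of a pair whose code is one
    less. *)
Lemma cpairK m n : cunpair (cpair m n) = (m, n).
Proof.
have [z zE] : exists z, cpair m n = z by exists (cpair m n).
elim: z m n zE => [|z IHz] m n.
  by have := leq_cpair m n; case: m n => [|m] [|n] //; lia.
have cnextP p : cpair (cnext p).1 (cnext p).2 = z.+1 ->
    cunpair (cpair (cnext p).1 (cnext p).2) = ((cnext p).1, (cnext p).2).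
  rewrite cpair_next => -[zE]; rewrite [LHS]/= -/(cunpair _) (IHz _ _ zE).
  by case: p {zE} => [[|m'] n'].
case: n => [|n]; last exact: (cnextP (m.+1, n)).
by case: m => [//|m]; apply: (cnextP (0, m)).
Qed.

Lemma cfstK m n : cfst (cpair m n) = m. Proof. by rewrite /cfst cpairK. Qed.
Lemma csndK m n : csnd (cpair m n) = n. Proof. by rewrite /csnd cpairK. Qed.
Definition cpK := (cfstK, csndK).

(** The first argument is fuel; by [size_encode] the code itself is enough of it. *)
Fixpoint decode_rec n z : seq nat :=
  if n is n'.+1 then
    if z is z'.+1 then cfst z' :: decode_rec n' (csnd z') else [::]
  else [::].

Definition decode z := decode_rec z z.

Lemma size_encode s : size s <= encode_seq s.
Proof.
elim: s => //= x s IHs; rewrite ltnS (leq_trans IHs) //.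
by have := leq_cpair x (encode_seq s); lia.
Qed.

Lemma encodeK s : decode (encode_seq s) = s.
Proof.
rewrite /decode; have := size_encode s; move: {1 2}(encode_seq s) => n.
by elim: s n => [|x s IHs] [|n] //=; rewrite !cpK => /IHs->.
Qed.

Definition computable (f : nat -> nat) : Prop :=
  exists c, forall x, pr_eval c x (f x).

Definition computable2 (f : nat -> nat -> nat) : Prop :=
  computable (fun z => f (cfst z) (csnd z)).

Lemma comp_ext f g : f =1 g -> computable f -> computable g.
Proof. by move=> fg [c cP]; exists c => x; rewrite -fg. Qed.

Lemma comp_fst : computable cfst.
Proof. by exists PLeft => x; rewrite -{1}(cunpairK x); apply: eval_left. Qed.

Lemma comp_snd : computable csnd.
Proof. by exists PRight => x; rewrite -{1}(cunpairK x); apply: eval_right. Qed.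

Lemma comp_pair f g :
  computable f -> computable g -> computable (fun x => cpair (f x) (g x)).
Proof.
by move=> [c cP] [d dP]; exists (PPair c d) => x; apply: eval_pair.
Qed.

Lemma comp_id : computable id.
Proof.
by apply: (comp_ext cunpairK); apply: comp_pair; [apply: comp_fst | apply: comp_snd].
Qed.

Lemma comp_comp f g : computable f -> computable g -> computable (fun x => f (g x)).
Proof.
by move=> [c cP] [d dP]; exists (PComp c d) => x; apply: eval_comp (dP x) (cP _).
Qed.

Lemma comp_comp2 f g h : computable2 f -> computable g -> computable h ->
  computable (fun x => f (g x) (h x)).
Proof.
move=> cf cg ch; apply: comp_ext (comp_comp cf (comp_pair cg ch)) => x /=.
by rewrite !cpK.
Qed.

Lemma comp_succ f : computable f -> computable (fun x => (f x).+1).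
Proof. by apply: comp_comp; exists PSucc; apply: eval_succ. Qed.

Lemma comp_const k : computable (fun=> k).
Proof.
by elim: k => [|k IHk]; [exists PZero; apply: eval_zero | apply: comp_succ].
Qed.

(** The recursion scheme to which loops, conditionals and arithmetic are reduced below. *)
Lemma comp_rec (u : nat -> nat) (v : nat -> nat) (w : nat -> nat -> nat -> nat) :
    computable u -> computable v ->
    computable (fun z => w (cfst z) (cfst (csnd z)) (csnd (csnd z))) ->
  computable (fun x => nat_rec (fun=> nat) (v x) (w x) (u x)).
Proof.
move=> cu [c cP] [d dP].
suff crec: computable2 (fun x n => nat_rec (fun=> nat) (v x) (w x) n).
  exact: (comp_comp2 crec comp_id cu).
exists (PRec c d) => z; rewrite -{1}(cunpairK z).
elim: (csnd z) => [|n IHn] /=; first exact: eval_rec0.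
apply: eval_recS IHn _.
by have := dP (cpair (cfst z) (cpair n (nat_rec (fun=> nat) (v (cfst z)) (w (cfst z)) n)));
  rewrite !cpK.
Qed.

Lemma comp_iter (u v : nat -> nat) (w : nat -> nat -> nat) :
    computable u -> computable v -> computable2 w ->
  computable (fun x => iter (u x) (w x) (v x)).
Proof.
move=> cu cv cw.
apply: (@comp_ext (fun x => nat_rec (fun=> nat) (v x) (fun _ => w x) (u x))).
  by move=> x; elim: (u x) => //= n ->.
apply: comp_rec => //; apply: comp_comp2 cw _ _; first exact: comp_fst.
by apply: comp_comp comp_snd comp_snd.
Qed.

Lemma comp_if (b : nat -> bool) f g :
    computable (fun x => b x : nat) -> computable f -> computable g ->
  computable (fun x => if b x then f x else g x).
Proof.
move=> cb cf cg.
apply: (@comp_ext (fun x => nat_rec (fun=> nat) (g x) (fun _ _ => f x) (b x))).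
  by move=> x; case: (b x).
by apply: comp_rec => //; apply: comp_comp cf comp_fst.
Qed.

Lemma comp_pred f : computable f -> computable (fun x => (f x).-1).
Proof.
apply: (@comp_comp predn); apply: (@comp_ext (fun x => nat_rec (fun=> nat) 0 (fun m _ => m) x)).
  by case.
apply: comp_rec; [exact: comp_id|exact: comp_const|].
exact: comp_comp comp_fst comp_snd.
Qed.

Lemma comp_add f g : computable f -> computable g -> computable (fun x => f x + g x).
Proof.
move=> cf cg; apply: (@comp_ext (fun x => iter (f x) succn (g x))).
  by move=> x; elim: (f x) => //= n ->.
by apply: comp_iter => //; apply: comp_succ comp_snd.
Qed.

Lemma comp_mul f g : computable f -> computable g -> computable (fun x => f x * g x).
Proof.
move=> cf cg; apply: (@comp_ext (fun x => iter (f x) (addn (g x)) 0)).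
  by move=> x; elim: (f x) => //= n ->; rewrite mulSn.
apply: (@comp_iter f (fun=> 0) (fun x => addn (g x))) => //; first exact: comp_const.
by apply: comp_add; [apply: comp_comp cg comp_fst | apply: comp_snd].
Qed.

Lemma comp_exp f g : computable f -> computable g -> computable (fun x => f x ^ g x).
Proof.
move=> cf cg; apply: (@comp_ext (fun x => iter (g x) (muln (f x)) 1)).
  by move=> x; elim: (g x) => //= n ->; rewrite expnS.
apply: (@comp_iter g (fun=> 1) (fun x => muln (f x))) => //; first exact: comp_const.
by apply: comp_mul; [apply: comp_comp cf comp_fst | apply: comp_snd].
Qed.

Lemma comp_sub f g : computable f -> computable g -> computable (fun x => f x - g x).
Proof.
move=> cf cg; apply: (@comp_ext (fun x => iter (g x) predn (f x))).
  by move=> x; elim: (g x) => [|n /= ->]; rewrite ?subn0 ?subnS.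
by apply: comp_iter => //; apply: comp_pred comp_snd.
Qed.

Lemma comp_eq0 f : computable f -> computable (fun x => f x == 0 : nat).
Proof.
move=> cf; apply: (@comp_ext (fun x => 1 - f x)); last exact/comp_sub/cf/comp_const.
by move=> x; case: (f x).
Qed.

Lemma comp_eq f g :
  computable f -> computable g -> computable (fun x => f x == g x : nat).
Proof.
move=> cf cg; apply: (@comp_ext (fun x => (f x - g x) + (g x - f x) == 0)).
  by move=> x; congr nat_of_bool; apply/eqP/eqP; lia.
by apply: comp_eq0; apply: comp_add; apply: comp_sub.
Qed.

Lemma comp_leq f g :
  computable f -> computable g -> computable (fun x => f x <= g x : nat).
Proof. by move=> cf cg; apply/comp_eq0/comp_sub. Qed.

Lemma comp_not (b : nat -> bool) :
  computable (fun x => b x : nat) -> computable (fun x => ~~ b x : nat).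
Proof.
move=> cb; apply: comp_ext (comp_if cb (comp_const 0) (comp_const 1)) => x.
by case: (b x).
Qed.

Lemma comp_and (b c : nat -> bool) :
    computable (fun x => b x : nat) -> computable (fun x => c x : nat) ->
  computable (fun x => b x && c x : nat).
Proof.
move=> cb cc; apply: comp_ext (comp_if cb cc (comp_const 0)) => x.
by case: (b x).
Qed.

Lemma comp_or (b c : nat -> bool) :
    computable (fun x => b x : nat) -> computable (fun x => c x : nat) ->
  computable (fun x => b x || c x : nat).
Proof.
move=> cb cc; apply: comp_ext (comp_if cb (comp_const 1) cc) => x.
by case: (b x).
Qed.

Lemma comp_odd f : computable f -> computable (fun x => odd (f x) : nat).
Proof.
move=> cf; apply: (@comp_ext (fun x => iter (f x) (fun b => 1 - b) 0)).
  by move=> x; elim: (f x) => //= n ->; case: (odd n).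
apply: (@comp_iter f (fun=> 0) (fun _ b => 1 - b)) => //; first exact: comp_const.
exact: comp_sub (comp_const 1) comp_snd.
Qed.

(** A counter that is reset on reaching [d]; for [d = 0] it is never reset, in agreement with
    [m %% 0 = m]. *)
Lemma iter_modn m d :
  iter m (fun r => if r.+1 == d then 0 else r.+1) 0 = m %% d.
Proof.
case: d => [|d]; first by rewrite modn0; elim: m => //= m ->.
elim: m => [|m IHm]; first by rewrite mod0n.
rewrite iterS IHm eqSS -[in RHS]addn1 -modnDml addn1.
case: eqP => [->|md]; first by rewrite modnn.
by rewrite [RHS]modn_small // ltnS ltn_neqAle -ltnS ltn_pmod // andbT; apply/eqP.
Qed.

Lemma comp_mod f g : computable f -> computable g -> computable (fun x => f x %% g x).
Proof.
move=> cf cg; apply: (comp_ext (fun x => iter_modn (f x) (g x))).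
apply: (@comp_iter f (fun=> 0) (fun x r => if r.+1 == g x then 0 else r.+1)) => //.
  exact: comp_const.
apply: comp_if; last exact: comp_succ comp_snd.
  exact: comp_eq (comp_succ comp_snd) (comp_comp cg comp_fst).
exact: comp_const.
Qed.

Lemma comp_has (b : nat -> nat -> bool) (n : nat -> nat) :
    computable n -> computable2 (fun x k => b x k) ->
  computable (fun x => has (b x) (iota 0 (n x)) : nat).
Proof.
move=> cn cb.
apply: (@comp_ext (fun x => nat_rec (fun=> nat) 0 (fun k a => (a != 0) || b x k : nat) (n x))).
  move=> x; elim: (n x) => [|k IHk]; first by [].
  rewrite -[k.+1]addn1 iotaD has_cat add0n /= orbF addn1 /= IHk.
  by case: (has _ _).
apply: (@comp_rec n (fun=> 0) (fun x k a => (a != 0) || b x k)) => //; first exact: comp_const.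
apply: comp_or; first exact/comp_not/comp_eq0/(comp_comp comp_snd)/comp_snd.
apply: (comp_comp2 cb); first exact: comp_fst.
exact: comp_comp comp_fst comp_snd.
Qed.

Lemma comp_all_iota (b : nat -> nat -> bool) (n : nat -> nat) :
    computable n -> computable2 (fun x k => b x k) ->
  computable (fun x => all (b x) (iota 0 (n x)) : nat).
Proof.
move=> cn cb.
apply: (@comp_ext (fun x => ~~ has (fun k => ~~ b x k) (iota 0 (n x)))).
  by move=> x; rewrite has_predC negbK.
by apply/comp_not/comp_has => //; apply: comp_not cb.
Qed.

Lemma comp_foldl (g : nat -> nat -> nat -> nat) (i l : nat -> nat) :
    computable i -> computable l ->
    computable (fun z => g (cfst z) (cfst (csnd z)) (csnd (csnd z))) ->
  computable (fun x => foldl (g x) (i x) (decode (l x))).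
Proof.
move=> ci cl cg.
(* The state pairs the code of the remaining list with the accumulator. It stays constant once the
   list is exhausted, so the code of the list can serve as the number of iterations. *)
pose step x st := if cfst st == 0 then st
  else cpair (csnd (cfst st).-1) (g x (csnd st) (cfst (cfst st).-1)).
apply: (@comp_ext (fun x => csnd (iter (l x) (step x) (cpair (l x) (i x))))).
  move=> x; rewrite /decode; move: {1 3}(l x) => n; move: (l x) => m.
  elim: n m (i x) => [|n IHn] m a; first by rewrite csndK.
  rewrite iterSr /=; case: m => [|m]; rewrite {2}/step !cpK //=.
  have -> : iter n (step x) (cpair 0 a) = cpair 0 a; last by rewrite csndK.
  by elim: n {IHn} => //= k ->; rewrite /step !cpK.
apply: comp_comp comp_snd _; apply: comp_iter => //; first exact: comp_pair.
have c1 := comp_comp comp_fst comp_snd; have c2 := comp_pred c1.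
apply: comp_if; [exact: comp_eq0|exact: comp_snd|].
apply: comp_pair; first exact: comp_comp comp_snd c2.
apply: comp_ext (comp_comp cg (comp_pair comp_fst (comp_pair
  (comp_comp comp_snd comp_snd) (comp_comp comp_fst c2)))) => z.
by rewrite !cpK.
Qed.

Lemma comp_double f : computable f -> computable (fun x => (f x).*2).
Proof.
by move=> cf; apply: comp_ext (comp_add cf cf) => x; rewrite addnn.
Qed.

Ltac comp :=
  lazymatch goal with
  | |- computable2 _ => rewrite /computable2; cbv beta; comp
  | |- computable (fun _ => ?k) => exact: comp_const
  | |- computable (fun x => x) => exact: comp_id
  | |- computable cfst => exact: comp_fst
  | |- computable csnd => exact: comp_snd
  | |- computable (fun x => cfst (@?f x)) => apply: (@comp_comp cfst f); comp
  | |- computable (fun x => csnd (@?f x)) => apply: (@comp_comp csnd f); comp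
  | |- computable (fun x => cpair (@?f x) (@?g x)) => apply: (@comp_pair f g); comp
  | |- computable (fun x => (@?f x).+1) => apply: (@comp_succ f); comp
  | |- computable (fun x => (@?f x).-1) => apply: (@comp_pred f); comp
  | |- computable (fun x => (@?f x).*2) => apply: (@comp_double f); comp
  | |- computable (fun x => @?f x + @?g x) => apply: (@comp_add f g); comp
  | |- computable (fun x => @?f x - @?g x) => apply: (@comp_sub f g); comp
  | |- computable (fun x => @?f x * @?g x) => apply: (@comp_mul f g); comp
  | |- computable (fun x => @?f x ^ @?g x) => apply: (@comp_exp f g); comp
  | |- computable (fun x => @?f x %% @?g x) => apply: (@comp_mod f g); comp
  | |- computable (fun x => nat_of_bool (@?f x == @?g x)) => apply: (@comp_eq f g); comp
  | |- computable (fun x => nat_of_bool (@?f x <= @?g x)) => apply: (@comp_leq f g); comp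
  | |- computable (fun x => nat_of_bool (~~ @?f x)) => apply: (@comp_not f); comp
  | |- computable (fun x => nat_of_bool (odd (@?f x))) => apply: (@comp_odd f); comp
  | |- computable (fun x => nat_of_bool (@?f x && @?g x)) => apply: (@comp_and f g); comp
  | |- computable (fun x => nat_of_bool (@?f x || @?g x)) => apply: (@comp_or f g); comp
  | |- computable _ => first [eassumption | simple apply comp_if; comp | idtac]
  end.

(** * An abstract machine *)

(* A state is [cpair m (cpair v k)]. With [m = p.+2] it is about to run the
   program with code [p] on [v], with [m = 1] it returns the value [v]; in both
   cases [k] codes the stack of pending frames. States with [m = 0] are dead,
   so that a run returns on the empty stack at most once. *)
Definition push fr k := (cpair fr k).+1.

(** Frames with tags 0 and 1 wait for the first and second component of a pair, 2 for the inner
    function of a composition, 3 for the previous value of a recursion, 4 for a trial value of a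
    minimization. Program tags are those of [pcode]. *)
Definition mstep (st : nat) : nat :=
  let m := cfst st in let v := cfst (csnd st) in let k := csnd (csnd st) in
  let run p x k' := cpair p.+2 (cpair x k') in
  let ret x k' := cpair 1 (cpair x k') in
  if m == 0 then st else
  if m == 1 then
    if k == 0 then cpair 0 (cpair v k) else
    let tag := cfst (cfst k.-1) in let d := csnd (cfst k.-1) in
    let k' := csnd k.-1 in
    if tag == 0 then run (cfst d) (csnd d) (push (cpair 1 v) k') else
    if tag == 1 then ret (cpair d v) k' else
    if tag == 2 then run d v k' else
    if tag == 3 then
      run (cfst d) (cpair (cfst (csnd d)) (cpair (csnd (csnd d)) v)) k' else
    if v == 0 then ret (csnd (csnd d)) k' else
    let y := cpair (cfst (csnd d)) (csnd (csnd d)).+1 in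
    run (cfst d) y (push (cpair 4 (cpair (cfst d) y)) k')
  else
  let tag := cfst m.-2 in let d := csnd m.-2 in
  if tag == 0 then ret 0 k else
  if tag == 1 then ret v.+1 k else
  if tag == 2 then ret (cfst v) k else
  if tag == 3 then ret (csnd v) k else
  if tag == 4 then run (cfst d) v (push (cpair 0 (cpair (csnd d) v)) k) else
  if tag == 5 then run (csnd d) v (push (cpair 2 (cfst d)) k) else
  if tag == 6 then
    if csnd v == 0 then run (cfst d) (cfst v) k else
    let y := cpair (cfst v) (csnd v).-1 in
    run m.-2 y (push (cpair 3 (cpair (csnd d) y)) k)
  else
  run d (cpair v 0) (push (cpair 4 (cpair d (cpair v 0))) k).

Fixpoint pcode (c : partrec) : nat :=
  match c with
  | PZero => cpair 0 0
  | PSucc => cpair 1 0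
  | PLeft => cpair 2 0
  | PRight => cpair 3 0
  | PPair f g => cpair 4 (cpair (pcode f) (pcode g))
  | PComp f g => cpair 5 (cpair (pcode f) (pcode g))
  | PRec f g => cpair 6 (cpair (pcode f) (pcode g))
  | PMu f => cpair 7 (pcode f)
  end.

Definition reach a b := exists s, iter s mstep a = b.

Lemma reach_step a b : reach (mstep a) b -> reach a b.
Proof. by move=> [s <-]; exists s.+1; rewrite iterSr. Qed.

Lemma reach_trans b a c : reach a b -> reach b c -> reach a c.
Proof. by move=> [s <-] [s' <-]; exists (s' + s); rewrite iterD. Qed.

Ltac mrun := rewrite /= /mstep /push ?cpK /= ?cpK /=.

(** Induction on the evaluation, for all stacks at once, since a subprogram runs above the frames of
    its callers. *)
Lemma machine_complete c x y k : pr_eval c x y ->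
  reach (cpair (pcode c).+2 (cpair x k)) (cpair 1 (cpair y k)).
Proof.
move=> cxy; elim: cxy k => {c x y}.
- by move=> x k; exists 1; mrun.
- by move=> x k; exists 1; mrun.
- by move=> m n k; exists 1; mrun.
- by move=> m n k; exists 1; mrun.
- move=> f g x y z _ IHf _ IHg k; apply: reach_step.
  mrun; apply: reach_trans (IHf _) _; apply: reach_step.
  mrun; apply: reach_trans (IHg _) _; apply: reach_step.
  by mrun; exists 0.
- move=> f g x y z _ IHg _ IHf k; apply: reach_step.
  mrun; apply: reach_trans (IHg _) _; apply: reach_step.
  by mrun.
- move=> f g x y _ IHf k; apply: reach_step.
  by mrun.
- move=> f g x n y z _ IHr _ IHg k; apply: reach_step.
  mrun; apply: reach_trans (IHr _) _; apply: reach_step.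
  by mrun.
- move=> f x n v _ IHv _ IHn k; apply: reach_step.
  mrun.
  (* Loop invariant of the search: the trials below [m] return successors, so the machine comes to
     try [m]. *)
  suff IHm m : m <= n ->
      reach
        (cpair (pcode f).+2
          (cpair (cpair x 0) (push (cpair 4 (cpair (pcode f) (cpair x 0))) k)))
        (cpair (pcode f).+2
          (cpair (cpair x m) (push (cpair 4 (cpair (pcode f) (cpair x m))) k))).
    apply: reach_trans (IHm n (leqnn n)) _; apply: reach_trans (IHn _) _.
    by apply: reach_step; mrun; exists 0.
  elim: m => [|m IHm] ltmn; first by exists 0.
  apply: reach_trans (IHm (ltnW ltmn)) _; apply: reach_trans (IHv m ltmn _) _.
  by apply: reach_step; mrun; exists 0.
Qed.

Lemma comp_mstep : computable mstep.
Proof. by rewrite /mstep /push; cbv zeta beta; comp. Qed.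

(** * The word test *)

(* [qnat A x y] is [qfun A (x - y)], see below. *)
Definition qnat (A : nat -> bool) x y :=
  has (fun k => A k && (x %% 2 ^ k.+2 == (y + 2 ^ k) %% 2 ^ k.+2))
    (iota 0 (x + y).+1).

(** The state holds the height, the code of the list of heights at which [a] occurred, and a count
    whose parity is the constant added to [c]. Letters 0 and 1 are [a] and its inverse, which act
    alike over F_2; 2 and 3 are [t] and its inverse. *)
Definition hstep (A : nat -> bool) st l :=
  let h := cfst st in let hs := cfst (csnd st) in let q := csnd (csnd st) in
  if l <= 1 then
    cpair h (cpair (cpair h hs).+1
      (foldl (fun n h' => n + qnat A h h') q (decode hs)))
  else cpair (if l == 2 then h.+1 else h.-1) (cpair hs q).

(* Starting from height [size s] keeps all heights nonnegative. *)
Definition hrun A s := foldl (hstep A) (cpair (size s) (cpair 0 0)) s.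

(** The conditions: the total shift is 0 modulo [M], each residue modulo [M] occurs an even number
    of times among the heights of the letters [a], and the constant added to [c] vanishes. *)
Definition htest A M s :=
  let st := hrun A s in
  [&& cfst st %% M == size s %% M,
      all (fun i => ~~ odd (foldl (fun n h => n + (h %% M == i)) 0
                              (decode (cfst (csnd st))))) (iota 0 M)
    & ~~ odd (csnd (csnd st))].

(* With [period e = 2 ^ (4 * e + 2)], the action with [base_set e] on functions
   of that period has class at most [(period e).+1]. *)
Definition base_set (e k : nat) : bool := k == 4 * e.
Definition period e := 2 ^ (4 * e + 2).

(** Here [e.+2] is the mark for running program [e], whereas [(period e).+2] is its input n_e. *)
Definition conf e s := iter s mstep (cpair e.+2 (cpair (period e).+2 0)).

Definition passes e y :=
  all (fun r => htest (base_set e) (period e) (decode r)) (decode y).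

Definition halts_at e s :=
  [&& cfst (conf e s) == 1, csnd (csnd (conf e s)) == 0
    & passes e (cfst (csnd (conf e s)))].

(* The index [4 * cpair e s + 2] is as deep as wanted since [cpair e s >= e],
   and all indices are even, so that [cword_halt] can use the free index [k.+1]. *)
Definition index_set (e k : nat) : bool :=
  (k == 4 * e) ||
  has (fun s => (k == 4 * cpair e s + 2) && halts_at e s) (iota 0 k).

(** The modulus exceeds all heights of the word, so residues determine heights. For [e > size s] the
    set starts too late to be seen by the word. *)
Definition trivial_test s :=
  all (fun e => htest (index_set e) (size s).*2.+1 s) (iota 0 (size s).+1).

(** * Computability of the word test *)

Lemma comp_all_decode (b : nat -> nat -> bool) (l : nat -> nat) :
    computable l -> computable2 (fun x k => b x k) ->
  computable (fun x => all (b x) (decode (l x)) : nat).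
Proof.
move=> cl cb.
apply: (@comp_ext (fun x => foldl (fun a k => (a != 0) && b x k : nat) 1 (decode (l x)))).
  move=> x; rewrite -[RHS]/(true && all (b x) (decode (l x)) : nat).
  rewrite -[1]/(true : nat); elim: (decode _) true => [|k s IHs] a /=.
    by rewrite andbT.
  by rewrite andbA -IHs; case: a.
apply: (@comp_foldl (fun x a k => (a != 0) && b x k : nat) (fun=> 1)) => //.
  exact: comp_const.
comp; apply: (comp_comp2 cb); comp.
Qed.

Lemma comp_qnat (A : nat -> nat -> bool) f g : computable2 (fun e k => A e k) ->
  computable f -> computable g -> computable (fun x => qnat (A x) (f x) (g x) : nat).
Proof.
move=> cA cf cg; apply: (@comp_has (fun x k =>
  A x k && (f x %% 2 ^ k.+2 == (g x + 2 ^ k) %% 2 ^ k.+2))).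
  comp.
comp; [apply: (comp_comp cf)|apply: (comp_comp cg)]; comp.
Qed.

Lemma comp_size l : computable l -> computable (fun x => size (decode (l x))).
Proof.
move=> cl; apply: (@comp_ext (fun x => foldl (fun a k => a.+1) 0 (decode (l x)))).
  by move=> x; elim/last_ind: (decode _) => // s k IHs; rewrite foldl_rcons size_rcons IHs.
by apply: (@comp_foldl (fun x a k => a.+1) (fun=> 0)) => //; comp.
Qed.

Lemma comp_htest (A : nat -> nat -> bool) f l : computable2 (fun e k => A e k) ->
    computable f -> computable l ->
  computable (fun x => htest (A x) (f x) (decode (l x)) : nat).
Proof.
move=> cA cf cl.
have crun : computable (fun x => hrun (A x) (decode (l x))).
  apply: (@comp_foldl (fun x => hstep (A x))) => //.
    by comp; apply: comp_size.
  rewrite /hstep; cbv zeta beta; comp.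
  apply: (@comp_foldl (fun x n h' => n + qnat (A (cfst x)) (cfst (cfst (csnd x))) h')); comp.
  apply: (@comp_qnat (fun z => A (cfst (cfst z)))); comp.
  by apply: (comp_comp2 cA); comp.
rewrite /htest; cbv zeta beta; comp.
- by apply: comp_size.
- apply: (@comp_all_iota (fun x i => ~~ odd (foldl (fun n h => n + (h %% (f x) == i)) 0
    (decode (cfst (csnd (hrun (A x) (decode (l x))))))))) => //; comp.
  apply: (@comp_foldl (fun z n h => n + (h %% f (cfst z) == csnd z)) (fun=> 0)); comp.
    by apply: (comp_comp crun); comp.
  by apply: (comp_comp cf); comp.
Qed.

Lemma comp_period f : computable f -> computable (fun x => period (f x)).
Proof. by move=> cf; rewrite /period; comp. Qed.

Lemma comp_conf : computable2 conf.
Proof.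
rewrite /computable2 /conf.
apply: (@comp_iter csnd (fun z => cpair (cfst z).+2 (cpair (period (cfst z)).+2 0)) (fun=> mstep)).
- comp.
- by comp; apply: comp_period; comp.
by apply: (comp_comp comp_mstep); comp.
Qed.

Lemma comp_passes : computable2 (fun e y => passes e y).
Proof.
rewrite /computable2 /passes.
apply: (@comp_all_decode (fun z r => htest (base_set (cfst z)) (period (cfst z)) (decode r))).
  comp.
apply: (@comp_htest (fun z => base_set (cfst (cfst z)))); comp.
  by rewrite /base_set; comp.
by apply: comp_period; comp.
Qed.

Lemma comp_halts_at : computable2 (fun e s => halts_at e s).
Proof.
have cc := comp_conf; rewrite /computable2 in cc.
by rewrite /halts_at; comp; apply: (comp_comp2 comp_passes); comp.
Qed.

Lemma comp_index_set : computable2 (fun e k => index_set e k).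
Proof.
rewrite /computable2 /index_set; comp.
apply: (@comp_has (fun z s => (csnd z == 4 * cpair (cfst z) s + 2) && halts_at (cfst z) s)).
  comp.
by comp; apply: (comp_comp2 comp_halts_at); comp.
Qed.

Lemma comp_trivial_test : computable (fun z => trivial_test (decode z)).
Proof.
have cs := comp_size comp_id.
apply: (@comp_all_iota (fun z e => htest (index_set e) (size (decode z)).*2.+1 (decode z))).
  exact: comp_succ.
apply: (@comp_htest (fun z => index_set (csnd z)) (fun z => (size (decode (cfst z))).*2.+1)).
- by apply: (comp_comp2 comp_index_set); comp.
- by comp; apply: comp_size; comp.
by comp.
Qed.

(** * The group *)

Definition config : Type := ((int -> bool) * bool * bool)%type.

Definition vadd (u v : config) : config :=
  (fun j => u.1.1 j (+) v.1.1 j, u.1.2 (+) v.1.2, u.2 (+) v.2).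

Definition vzero : config := (fun=> false, false, false).

Lemma configP (u v : config) :
  u.1.1 =1 v.1.1 -> u.1.2 = v.1.2 -> u.2 = v.2 -> u = v.
Proof.
by case: u v => [[phi c] r] [[psi d] s] /= /funext -> -> ->.
Qed.

Lemma vaddA : associative vadd.
Proof. by move=> u v w; apply: configP => [j||] /=; rewrite addbA. Qed.

Lemma vaddC : commutative vadd.
Proof. by move=> u v; apply: configP => [j||] /=; rewrite addbC. Qed.

Lemma vaddvv v : vadd v v = vzero.
Proof. by apply: configP => [j||] /=; rewrite addbb. Qed.

Lemma vadd0 v : vadd v vzero = v.
Proof. by apply: configP => [j||] /=; rewrite addbF. Qed.

Lemma vaddK u v : vadd (vadd u v) v = u.
Proof. by rewrite -vaddA vaddvv vadd0. Qed.

(* A configuration [(phi, c, r)] is a vector over F_2; [lact Q] makes the first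
   generator [a] act by [(phi + r Q, c + phi 0, r)] and the second generator [t]
   by shifting [phi]. Words act on the right: their first letter acts first. *)
Definition lact (Q : int -> bool) (l : 'I_2 * bool) (v : config) : config :=
  if l.1 == ord0 then
    (fun j => v.1.1 j (+) (v.2 && Q j), v.1.2 (+) v.1.1 0%R, v.2)
  else (fun j => v.1.1 (j + (if l.2 then -1 else 1))%R, v.1.2, v.2).

Definition wact Q (w : word 2) v := foldl (fun v l => lact Q l v) v w.

Definition winv (w : word 2) : word 2 := rev [seq (l.1, ~~ l.2) | l <- w].

Lemma wact_cat Q w w' v : wact Q (w ++ w') v = wact Q w' (wact Q w v).
Proof. exact: foldl_cat. Qed.

Lemma wact_rcons Q w l v : wact Q (rcons w l) v = lact Q l (wact Q w v).
Proof. exact: foldl_rcons. Qed.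

Lemma winvK : involutive winv.
Proof.
move=> w; rewrite /winv map_rev revK -map_comp map_id_in // => -[i b] _ /=.
by rewrite negbK.
Qed.

Lemma lactD Q l : {morph lact Q l : u v / vadd u v}.
Proof.
move=> u v; rewrite /lact; case: ifP => _; last exact: configP.
by apply: configP => [j||] //=; rewrite ?andb_addl addbACA.
Qed.

Lemma wactD Q w : {morph wact Q w : u v / vadd u v}.
Proof.
elim: w => // l w IHw u v.
exact: etrans (congr1 (wact Q w) (lactD Q l u v)) (IHw _ _).
Qed.

Section WordInverse.
Variable Q : int -> bool.
Hypothesis Q0 : Q 0%R = false.

(** The letter [a] acts as an involution: twice applied, it adds [r Q] twice to [phi], and
    [r Q 0 = 0] to [c]. *)
Lemma lactK i b : cancel (lact Q (i, b)) (lact Q (i, ~~ b)).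
Proof.
move=> v; rewrite /lact /=; case: (i == ord0); apply: configP => [j||] //=.
- by rewrite -addbA addbb addbF.
- by rewrite Q0 andbF addbF -addbA addbb addbF.
- by case: b => /=; rewrite ?addrNK ?addrK // -addrA addNr addr0.
Qed.

Lemma wactK w : cancel (wact Q w) (wact Q (winv w)).
Proof.
elim: w => // -[i b] w IHw v.
by rewrite /winv map_cons rev_cons wact_rcons [wact Q (_ :: _) v]/= -/(wact _ _ _)
  -/(winv w) IHw lactK.
Qed.

Lemma wactVK w : cancel (wact Q (winv w)) (wact Q w).
Proof. by rewrite -{2}(winvK w); apply: wactK. Qed.

End WordInverse.

(* Since [- 2 ^ k] is not of the form [(4 * j + 1) * 2 ^ l], the value
   [Q m (+) Q (- m)] of the commutator of [a ^ (t ^ m)] and [a] tells at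
   [m = 2 ^ k] whether [k] is in [A]. *)
Definition qfun (A : nat -> bool) (i : int) : bool :=
  `[< exists k j, A k /\ i = ((4 * j + 1) * (2 ^ k)%:Z)%R >].

(** * Values and periods of [qfun] *)

Lemma odd_part_inj (i j : int) k l :
  ((2 * i + 1) * (2 ^ k)%:Z = (2 * j + 1) * (2 ^ l)%:Z)%R -> k = l.
Proof.
suff wl (i' j' : int) k' d :
    ((2 * i' + 1) * (2 ^ k')%:Z = (2 * j' + 1) * (2 ^ (k' + d))%:Z)%R -> d = 0.
  case/orP: (leq_total k l) => /subnKC <-.
    by move/wl => ->; rewrite addn0.
  by move/esym/wl => ->; rewrite addn0.
case: d => // d; rewrite addnS expnS expnD.
move: (2 ^ k') (2 ^ d) (expn_gt0 2 k') => P D P0 eqPD; exfalso.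
have {}eqPD : (P%:Z * (2 * i' + 1) = P%:Z * ((2 * j' + 1) * (2 * D%:Z)))%R by nia.
have /mulfI injP : (P%:Z != 0)%R by lia.
by move/injP: eqPD; nia.
Qed.

Lemma qfun_pow A k : qfun A (2 ^ k)%:Z = A k.
Proof.
apply/asboolP/idP => [[l] [j] [Al]|Ak]; last by exists k, 0%R; split=> //; lia.
move=> kl; rewrite (@odd_part_inj 0 (2 * j) k l) //.
by move: kl; lia.
Qed.

Lemma qfun_opp_pow A k : qfun A (- (2 ^ k)%:Z)%R = false.
Proof.
apply/asboolP => -[l] [j] [_ kl].
have lk : k = l by apply: (@odd_part_inj (-1) (2 * j)); move: kl; lia.
move: kl; rewrite lk; have := expn_gt0 2 l; move: (2 ^ l) => P /= P0 PE.
have /mulfI injP : (P%:Z != 0)%R by lia.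
have /injP : (P%:Z * -1 = P%:Z * (4 * j + 1))%R by lia.
by lia.
Qed.

Lemma qfun0 A : qfun A 0%R = false.
Proof.
apply/asboolP => -[k] [j] [_]; have := expn_gt0 2 k; move: (2 ^ k) => P /= P0 /esym/eqP.
by rewrite mulf_eq0; lia.
Qed.

(** As [k + 2 <= K + 1], adding a multiple of [2 ^ K.+1] only changes the [j] in
    [(4 * j + 1) * 2 ^ k]. *)
Lemma qfun_periodic (A : nat -> bool) K : (forall k, A k -> k < K) ->
  forall i j, qfun A (i + j * (2 ^ K.+1)%:Z)%R = qfun A i.
Proof.
move=> AK.
suff imp i j : qfun A i -> qfun A (i + j * (2 ^ K.+1)%:Z)%R.
  move=> i j; apply/idP/idP; last exact: imp.
  by move/(imp _ (- j)%R); rewrite mulNr addrK.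
move=> /asboolP[k] [l] [Ak ->]; apply/asboolP.
have /subnKC <- := AK k Ak; exists k, (l + j * (2 ^ (K - k.+1))%:Z)%R; split=> //.
by rewrite addSn addnC -!addnS expnD !expnS; nia.
Qed.

Lemma eqn_mod_int (x y d : nat) :
  (x %% d == y %% d) = `[< exists j : int, (x%:Z = y%:Z + j * d%:Z)%R >].
Proof.
apply/eqP/asboolP => [xy|[j xy]].
  exists ((x %/ d)%:Z - (y %/ d)%:Z)%R.
  by rewrite {1}(divn_eq x d) {1}(divn_eq y d) xy; lia.
case: j xy => j xy.
  have -> : x = j * d + y by lia.
  by rewrite modnMDl.
have -> : y = j.+1 * d + x by nia.
by rewrite modnMDl.
Qed.

(** The congruence modulo [2 ^ k.+2] says that [x - y] is some [(4 * j + 1) * 2 ^ k]; then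
    [k < 2 ^ k <= x + y] bounds the search. *)
Lemma qnatE A x y : qnat A x y = qfun A (x%:Z - y%:Z)%R.
Proof.
apply/hasP/asboolP => [[k _ /andP[Ak]]|[k] [j] [Ak xy]].
  rewrite eqn_mod_int => /asboolP[j xy]; exists k, j; split=> //.
  by move: xy; rewrite !expnS; lia.
exists k; last first.
  by rewrite Ak eqn_mod_int; apply/asboolP; exists j; rewrite !expnS; lia.
rewrite mem_iota /= add0n ltnS ltnW // (leq_trans (ltn_expl k (ltnSn 1))) //.
move: xy; move: (2 ^ k) => P xy.
have [//|] := leqP P (x + y) => Pxy.
have : (4 * j + 1 <= 0 \/ 1 <= 4 * j + 1)%R by lia.
by case=> jj; nia.
Qed.

Lemma qfun_small (A : nat -> bool) K (i : int) : (forall k, A k -> K <= k) -> (`|i| < 2 ^ K)%N ->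
  qfun A i = false.
Proof.
move=> AK; apply: contraTF => /asboolP[k] [j] [/AK leKk ->]; rewrite -leqNgt.
rewrite abszM (leq_trans (leq_pexp2l (ltn0Sn 1) leKk)) // absz_nat leq_pmull //.
by lia.
Qed.

Section Group.
Variable A : nat -> nat -> bool.

(** A family of maps that one word realizes at all [e] at once. The word is not part of the data, so
    equality is equality of actions. *)
Record gelt : Type := Gelt {
  gfun :> nat -> config -> config;
  gfunP : exists w, gfun = fun e => wact (qfun (A e)) w
}.

Lemma geltP (x y : gelt) : (forall e v, x e v = y e v) -> x = y.
Proof.
case: x y => [f fP] [g gP] /= fg.
have {}fg : f = g by apply/funext => e; apply/funext => v.
by case: g / fg in gP *; congr Gelt; apply: Prop_irrelevance.
Qed.

HB.instance Definition _ := gen_eqMixin gelt.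
HB.instance Definition _ := gen_choiceMixin gelt.

Definition gword w : gelt :=
  Gelt (ex_intro _ w (erefl (fun e => wact (qfun (A e)) w))).

Lemma gwordP x : exists w, x = gword w.
Proof. by have [w xw] := gfunP x; exists w; apply: geltP => e v; rewrite xw. Qed.

Definition word_of x := sval (cid (gwordP x)).

Lemma word_ofK x : gword (word_of x) = x.
Proof. by rewrite /word_of; case: cid. Qed.

Definition gmul x y := gword (word_of x ++ word_of y).
Definition ginv x := gword (winv (word_of x)).

Lemma gmul_fun x y e v : gmul x y e v = y e (x e v).
Proof. by rewrite /= wact_cat -{2}(word_ofK x) -{2}(word_ofK y). Qed.

Lemma gmulA : associative gmul.
Proof. by move=> x y z; apply: geltP => e v; rewrite !gmul_fun. Qed.

Lemma gmul1 : left_id (gword [::]) gmul.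
Proof. by move=> x; apply: geltP => e v; rewrite !gmul_fun. Qed.

Lemma gmulr1 : right_id (gword [::]) gmul.
Proof. by move=> x; apply: geltP => e v; rewrite !gmul_fun. Qed.

Lemma gmulV : left_inverse (gword [::]) ginv gmul.
Proof.
move=> x; apply: geltP => e v; rewrite !gmul_fun -{1}(word_ofK x).
exact: wactVK (qfun0 _) _ _.
Qed.

Lemma gmulrV : right_inverse (gword [::]) ginv gmul.
Proof.
move=> x; apply: geltP => e v; rewrite !gmul_fun -{2}(word_ofK x).
exact: wactK (qfun0 _) _ _.
Qed.

HB.instance Definition _ := isGroup.Build gelt gmulA gmul1 gmulr1 gmulV gmulrV.

Lemma gfunM (x y : gelt) e v : (x * y)%g e v = y e (x e v).
Proof. exact: gmul_fun. Qed.

Lemma gwordM w w' : gword (w ++ w') = (gword w * gword w')%g.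
Proof. by apply: geltP => e v; rewrite gfunM /= wact_cat. Qed.

Lemma gwordV w : gword (winv w) = (gword w)^-1%g.
Proof.
apply/esym/mulg1_eq/geltP => e v; rewrite gfunM; exact: wactK (qfun0 _) _ _.
Qed.

Definition gens : 2.-tuple gelt := [tuple gword [:: (i, false)] | i < 2].

Lemma word_value_gens w : word_value gens w = gword w.
Proof.
elim: w => [|[i b] w IHw]; rewrite /word_value ?big_nil ?big_cons //=.
rewrite -cat1s gwordM -IHw; congr (_ * _)%g; rewrite tnth_mktuple.
by case: b => //; rewrite -gwordV.
Qed.

Lemma gens_generate : generates gens.
Proof.
apply/seteqP; split=> // x _; have [w ->] := gwordP x.
have [g1 gM gV] := generated_group [set x | x \in gens].
rewrite -word_value_gens /word_value.
elim/big_rec: _ => // -[i b] y _ gy; apply: gM => //=.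
have gi : generated [set x | x \in gens] (tnth gens i).
  by apply: sub_gen_smallest; apply: mem_tnth.
by case: b => //; apply: gV.
Qed.

End Group.

(** * Nilpotent quotients *)

Definition dif (phi : int -> bool) : int -> bool := fun j => phi j (+) phi (j + 1)%R.

(** The Frobenius identity [(1 + T) ^ (2 ^ k) = 1 + T ^ (2 ^ k)] over F_2, for the translation T. *)
Lemma iter_dif_pow k phi : iter (2 ^ k) dif phi = fun j => phi j (+) phi (j + (2 ^ k)%:Z)%R.
Proof.
elim: k phi => [//|k IHk] phi; rewrite expnS mul2n -addnn iterD !IHk.
apply/funext => j /=; rewrite -addbA; congr (_ (+) _); rewrite addbA addbb addFb.
by congr phi; lia.
Qed.

Lemma iter_difD k phi psi :
  iter k dif (fun j => phi j (+) psi j) = fun j => iter k dif phi j (+) iter k dif psi j.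
Proof.
by elim: k => //= k ->; apply/funext => j; rewrite /dif addbACA.
Qed.

Lemma iter_dif_shift k phi m :
  iter k dif (fun j => phi (j + m)%R) = fun j => iter k dif phi (j + m)%R.
Proof.
by elim: k => //= k ->; apply/funext => j; rewrite /dif addrAC.
Qed.

Lemma iter_dif0 k : iter k dif (fun=> false) = fun=> false.
Proof. by elim: k => //= k ->. Qed.

(** * The stability group of a chain of subspaces over F_2 *)

Section Chain.
Variable d : nat.

(** The chain is 0, then the [c]-line, then the kernels of [dif ^ i] with [r = 0] up to [i = d];
    from index [d.+2] on, [r] is free. *)
Definition chain i (v : config) : Prop :=
  if i is i'.+1 then
    iter (minn i' d) dif v.1.1 = (fun=> false) /\ (i' <= d -> v.2 = false)
  else v = vzero.

Lemma chain_top v : iter d dif v.1.1 = (fun=> false) -> chain d.+2 v.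
Proof.
move=> v0; split; rewrite ?ltnn //.
by have -> : minn d.+1 d = d by lia.
Qed.

Lemma chain0 i : chain i vzero.
Proof. by case: i => // i; split=> //=; apply: iter_dif0. Qed.

Lemma chainD i u v : chain i u -> chain i v -> chain i (vadd u v).
Proof.
case: i => [->->|i [u0 ur] [v0 vr]]; first exact: vaddvv.
split=> [|lid]; first by rewrite /= iter_difD u0 v0.
by rewrite /= ur ?vr.
Qed.

Lemma chainS i v : chain i v -> chain i.+1 v.
Proof.
case: i => [->|i [v0 vr]]; first exact: chain0.
split=> [|lid]; last exact/vr/ltnW.
have [lid|gid] : d <= i \/ i < d by lia.
  have -> : minn i.+1 d = d by lia.
  by move: v0; have -> : minn i d = d by lia.
have -> : minn i.+1 d = i.+1 by lia.
move: v0; have -> : minn i d = i by lia.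
by rewrite iterS => ->.
Qed.

Lemma chain_leq i k v : i <= k -> chain i v -> chain k v.
Proof.
by move/subnK <-; elim: (k - i) => // n IHn /IHn; apply: chainS.
Qed.

Variable Q : int -> bool.
Hypothesis Qd : iter d dif Q = fun=> false.

(** Here [a - 1] sends [phi] to the [c]-line and [r] to [r Q], which [dif ^ d] kills, up to the
    [c]-line; [t - 1] is [dif], and for the inverse of [t] a shift of it. *)
Lemma lact_chain l i v : chain i.+1 v -> chain i (vadd (lact Q l v) v).
Proof.
case: v => [[phi c] r] [/= phi0 r0]; rewrite /lact /=.
case: i => [|i] in phi0 r0 *.
  move: phi0; rewrite min0n /= r0 // => ->.
  by case: ifP => _; apply: configP => [j||] //=; rewrite ?addbb ?addbF ?addbb.
have phid : iter (minn i d) dif (dif phi) = fun=> false.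
  have [lid|gid] : d <= i \/ i < d by lia.
    have -> : minn i d = d by lia.
    rewrite -iterSr iterS; move: phi0; have -> : minn i.+1 d = d by lia.
    by move=> ->.
  rewrite -iterSr; move: phi0; have -> : minn i.+1 d = i.+1 by lia.
  by have -> : minn i d = i by lia.
split=> /=; case: ifP => _ /=; rewrite ?addbb //.
  have -> : (fun j => phi j (+) r && Q j (+) phi j) = (fun j => r && Q j).
    by apply/funext => j; rewrite addbAC addbb.
  have [lid|gid] : i <= d \/ d < i by lia.
    have -> : minn i d = i by lia.
    have [lid'|gid'] : i < d \/ d = i by lia.
      by rewrite r0 //= iter_dif0.
    by rewrite -gid'; case: (r) => //=; apply: iter_dif0.
  have -> : minn i d = d by lia.
  by case: (r) => //=; apply: iter_dif0.
case: l.2; last by rewrite -[RHS]phid; congr iter; apply/funext => j; rewrite addbC.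
have -> : (fun j => phi (j - 1)%R (+) phi j) = (fun j => dif phi (j - 1)%R).
  by apply/funext => j; rewrite /dif subrK.
by rewrite iter_dif_shift phid.
Qed.

(* For additive bijections this is the [k]-th term of the stability group
   of the chain, [f - 1] lowering it by [k] steps. *)
Definition stab k (f : config -> config) := forall i v,
  chain (i + k) v -> chain i (vadd (f v) v).

Lemma stab_chain k f i v : stab k f -> chain i v -> chain i (f v).
Proof.
move=> fk iv; rewrite -(vaddK (f v) v); apply: chainD => //; apply: fk.
by apply: chain_leq iv; apply: leq_addr.
Qed.

Lemma stab_comp k f g : stab k f -> stab k g -> stab k (fun v => g (f v)).
Proof.
move=> fk gk i v iv; rewrite -(vaddK (g (f v)) (f v)) -vaddA; apply: chainD.
  exact/gk/(stab_chain fk).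
exact: fk.
Qed.

Lemma wact_stab w : stab 1 (wact Q w).
Proof.
elim: w => [|l w IHw] i v; first by rewrite vaddvv => _; apply: chain0.
apply: (@stab_comp 1 (lact Q l) (wact Q w) _ IHw) => {i v} i v.
by rewrite addn1; apply: lact_chain.
Qed.

Lemma stab_inv k f g : {morph g : u v / vadd u v} ->
  cancel f g -> (forall i v, chain i v -> chain i (g v)) -> stab k f -> stab k g.
Proof.
move=> gD fK gc fk i v iv; rewrite vaddC -{1}(fK v) -gD; apply: gc.
exact: fk.
Qed.

(** The commutator minus 1 is [gf - fg] applied to [g' (f' v)], and [gf - fg = (g - 1)(f - 1) - (f -
    1)(g - 1)] lowers the chain by [k + 1] steps. *)
Lemma stab_comm k f g f' g' :
    {morph f : u v / vadd u v} -> {morph g : u v / vadd u v} ->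
    cancel f' f -> cancel g' g ->
    stab k f -> stab 1 g -> stab k f' -> stab 1 g' ->
  stab k.+1 (fun v => g (f (g' (f' v)))).
Proof.
move=> fD gD fK gK fk gk fk' gk' i v iv.
have iu : chain (i + k.+1) (g' (f' v)) by apply/(stab_chain gk')/(stab_chain fk').
suff {iu} comm u : chain (i + k.+1) u -> chain i (vadd (g (f u)) (f (g u))).
  by have := comm _ iu; rewrite gK fK.
move=> iu.
have -> : vadd (g (f u)) (f (g u)) =
    vadd (vadd (g (vadd (f u) u)) (vadd (f u) u)) (vadd (f (vadd (g u) u)) (vadd (g u) u)).
  rewrite fD gD; apply: configP => [j||] /=; move: (f u) (g u) (f (g u)) (g (f u)).
  - by move=> p q r s; move: (p.1.1 j) (q.1.1 j) (r.1.1 j) (s.1.1 j) (u.1.1 j);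
      do 5!case.
  - by move=> p q r s; move: p.1.2 q.1.2 r.1.2 s.1.2 u.1.2; do 5!case.
  - by move=> p q r s; move: p.2 q.2 r.2 s.2 u.2; do 5!case.
by apply: chainD; [apply: gk; apply: fk | apply: fk; apply: gk];
  rewrite -addnA ?addn1 ?add1n.
Qed.

End Chain.

Section LowerCentral.
Variables (A : nat -> nat -> bool) (e d : nat).
Hypothesis Ad : iter d dif (qfun (A e)) = fun=> false.

Lemma gfunD (x : gelt A) : {morph x e : u v / vadd u v}.
Proof. by have [w ->] := gwordP x; apply: wactD. Qed.

Lemma gfun_stab (x : gelt A) : stab d 1 (x e).
Proof. by have [w ->] := gwordP x; apply: wact_stab. Qed.

Lemma gfunK (x : gelt A) : cancel (x e) (x^-1%g e).
Proof. by move=> v; rewrite -gfunM mulgV. Qed.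

Lemma gfunVK (x : gelt A) : cancel (x^-1%g e) (x e).
Proof. by move=> v; rewrite -gfunM mulVg. Qed.

Lemma gfunV_stab k (x : gelt A) : stab d k (x e) -> stab d k (x^-1%g e).
Proof.
apply: stab_inv (gfunD _) (gfunK x) _ => i v.
exact/stab_chain/gfun_stab.
Qed.

Lemma stab_subgroup k : subgroup [set x : gelt A | stab d k (x e)].
Proof.
split=> [i v _|x y xk yk i v iv|x]; last exact: gfunV_stab.
  by rewrite vaddvv; apply: chain0.
by have -> := gfunM x y e v; apply: (stab_comp xk yk).
Qed.

Lemma lcs_stab n (x : gelt A) : lcs_set (gelt A) n.+1 x -> stab d n.+1 (x e).
Proof.
rewrite /lcs_set /=; elim: n x => [|n IHn] x; first by move=> _; apply: gfun_stab.
move=> xn; suff: [set y : gelt A | stab d n.+2 (y e)] x by [].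
apply: xn.
split=> [|_ [y] [z] [/IHn yn _ ->]]; first exact: stab_subgroup.
have -> : [~ y, z]%g = (y^-1 * z^-1 * y * z)%g by rewrite /commg /conjg !mulgA.
move=> i v iv; rewrite !gfunM.
by apply: (stab_comm (gfunD y) (gfunD z) (gfunVK y) (gfunVK z)) iv => //;
  try apply: gfunV_stab => //; apply: gfun_stab.
Qed.

(** The term [d.+2] of the series lowers [chain d d.+2] by [d.+2] steps, that is to 0. *)
Lemma lcs_fix (x : gelt A) v : lcs_set (gelt A) d.+2 x ->
  iter d dif v.1.1 = (fun=> false) -> x e v = v.
Proof.
move=> /lcs_stab xd /chain_top vd.
by rewrite -[RHS](vaddK _ (x e v)) vaddC [vadd v _]vaddC (xd 0 v vd) vadd0.
Qed.

End LowerCentral.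

Lemma quot_piV (G : groupType) (N : normalSubgroup G) (x : G) :
  quot_pi N x^-1%g = (quot_pi N x)^-1%g.
Proof. by rewrite -quot_invE. Qed.

Lemma quot_piR (G : groupType) (N : normalSubgroup G) (x y : G) :
  quot_pi N [~ x, y]%g = [~ quot_pi N x, quot_pi N y]%g.
Proof. by rewrite /commg /conjg !quot_piM !quot_piV. Qed.

Lemma quot_pi_eq1 (G : groupType) (N : normalSubgroup G) (x : G) :
  quot_pi N x = 1%g <-> normal_set N x.
Proof.
rewrite -[1%g]/(quot_pi N 1%g); split=> [/esym/quot_piP|Nx].
  by rewrite invg1 mul1g.
by apply/esym/quot_piP; rewrite invg1 mul1g.
Qed.

Lemma image_subgroup (G : groupType) (N : normalSubgroup G) (S : set G) :
  subgroup S -> subgroup [set quot_pi N x | x in S].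
Proof.
move=> [S1 SM SV]; split.
- by exists 1%g.
- by move=> _ _ [x Sx <-] [y Sy <-]; exists (x * y)%g; rewrite ?quot_piM //; apply: SM.
- by move=> _ [x Sx <-]; exists x^-1%g; rewrite ?quot_piV //; apply: SV.
Qed.

Lemma lcs_quot (G : groupType) (N : normalSubgroup G) n a :
  lcs_set (quot N) n a -> exists2 x, lcs_set G n x & a = quot_pi N x.
Proof.
rewrite /lcs_set; elim: n.-1 a => [|m IHm] a.
  by exists (repr a); rewrite ?quot_piK.
move=> am; have [|x xm <-] := am [set quot_pi N x | x in
    commutator_subgroup (iter m (fun A => commutator_subgroup A setT) setT) setT];
  last by exists x.
split=> [|_ [b] [c] [/IHm[x xm ->] _ ->]]; first exact/image_subgroup/generated_group.
rewrite -(quot_piK c) -quot_piR; exists [~ x, repr c]%g => //.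
by apply: sub_gen_smallest; exists x, (repr c).
Qed.

(** * Commutator calculus *)

(** The exponent sum of [t]. *)
Definition height (w : word 2) : int :=
  (\sum_(l <- w) if l.1 == ord0 then 0 else if l.2 then -1 else 1)%R.

Definition additive_form (L : (int -> bool) -> bool) :=
  forall phi psi, L (fun j => phi j (+) psi j) = L phi (+) L psi.

(** The shape of the action of words of height 0. Such maps are of Heisenberg type: their
    commutators change only [c]. *)
Definition transl (psi : int -> bool) (L : (int -> bool) -> bool) (k : bool)
    (v : config) : config :=
  (fun j => v.1.1 j (+) (v.2 && psi j), v.1.2 (+) L v.1.1 (+) (v.2 && k), v.2).

Lemma additive_scale L b phi : additive_form L ->
  L (fun j => b && phi j) = b && L phi.
Proof.
case: b => // LD; have := LD (fun=> false) (fun=> false).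
by case: (L _).
Qed.

Lemma wact_shape Q w : exists psi L k, additive_form L /\
  forall v, wact Q w v = (fun j => v.1.1 (j + height w)%R (+) (v.2 && psi j),
                          v.1.2 (+) L v.1.1 (+) (v.2 && k), v.2).
Proof.
elim: w => [|[i b] w [psi] [L] [k] [LD wE]].
  exists (fun=> false), (fun=> false), false; split=> // v.
  by apply: configP => [j||] //=; rewrite /height ?big_nil ?addr0 ?andbF ?addbF.
have ht : height ((i, b) :: w) = ((if i == ord0 then 0 else if b then -1 else 1) + height w)%R.
  by rewrite /height big_cons.
have [i0|i0] := boolP (i == ord0).
  exists (fun j => Q (j + height w)%R (+) psi j), (fun phi => phi 0%R (+) L phi), (L Q (+) k).
  split=> [phi chi|v]; first by rewrite LD addbACA.
  rewrite [LHS]wE /lact /= i0 /= ht i0 add0r; apply: configP => [j||] //=.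
    by rewrite -addbA andb_addr.
  rewrite LD (additive_scale v.2 Q LD) andb_addr !addbA; congr (_ (+) _).
exists psi, (fun phi => L (fun j => phi (j + (if b then -1 else 1))%R)), k.
split=> [phi chi|v]; first by rewrite -LD.
rewrite [LHS]wE /lact /= (negbTE i0) /= ht (negbTE i0); apply: configP => [j||] //=.
by congr (v.1.1 _ (+) _); rewrite addrAC addrA addrAC.
Qed.

Lemma height_cat w w' : height (w ++ w') = (height w + height w')%R.
Proof. by rewrite /height big_cat. Qed.

Lemma heightV w : height (winv w) = (- height w)%R.
Proof.
rewrite /height /winv (perm_big _ (permEl (perm_rev _))) big_map -sumrN.
by apply: eq_bigr => -[i b] _ /=; case: ifP => _; rewrite ?oppr0 //; case: b; rewrite ?opprK.
Qed.

Definition wcomm (u v : word 2) : word 2 := winv u ++ winv v ++ u ++ v.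

Lemma gword_comm A u v : gword A (wcomm u v) = [~ gword A u, gword A v]%g.
Proof. by rewrite /wcomm !gwordM !gwordV /commg /conjg !mulgA. Qed.

Lemma height_comm u v : height (wcomm u v) = 0%R.
Proof. by rewrite /wcomm !height_cat !heightV; lia. Qed.

Lemma height0_transl Q w : height w = 0%R ->
  exists psi L k, additive_form L /\ forall v, wact Q w v = transl psi L k v.
Proof.
have [psi [L [k [LD wE]]]] := wact_shape Q w => w0; exists psi, L, k; split=> // v.
by rewrite wE w0; apply: configP => [j||] //=; rewrite addr0.
Qed.

Lemma transl_winv Q w psi L k : Q 0%R = false -> additive_form L ->
  (forall v, wact Q w v = transl psi L k v) ->
  forall v, wact Q (winv w) v = transl psi L (k (+) L psi) v.
Proof.
move=> Q0 LD wE v; apply: (can_inj (wactK Q0 w)) => /=.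
rewrite wactVK // wE; apply: configP => [j||] //=.
  by rewrite -addbA addbb addbF.
rewrite LD (additive_scale v.2 psi LD) andb_addr.
clear wE; by move: v.1.2 (L v.1.1) v.2 k (L psi) => [] [] [] [] [].
Qed.

Lemma transl_comm Q u v psi L k chi M l : Q 0%R = false ->
  additive_form L -> additive_form M ->
  (forall x, wact Q u x = transl psi L k x) ->
  (forall x, wact Q v x = transl chi M l x) ->
  forall x, wact Q (wcomm u v) x = (x.1.1, x.1.2 (+) (x.2 && (L chi (+) M psi)), x.2).
Proof.
move=> Q0 LD MD uE vE x; rewrite /wcomm !wact_cat.
rewrite (transl_winv Q0 LD uE) (transl_winv Q0 MD vE) uE vE.
apply: configP => [j||] //=.
  by move: (x.1.1 j) x.2 (psi j) (chi j) => [] [] [] [].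
rewrite !(LD, MD, additive_scale _ _ LD, additive_scale _ _ MD).
clear uE vE; move: (x.1.2) (x.2) (L x.1.1) (M x.1.1) (L psi) (L chi) (M psi) (M chi) k l.
by do 10!case.
Qed.

Section Metabelian.
Variable A : nat -> nat -> bool.

Definition height0 : set (gelt A) := [set gword A w | w in [set w | height w = 0%R]].

Lemma height0_subgroup : subgroup height0.
Proof.
split; first by exists [::] => //=; rewrite /height big_nil.
  move=> _ _ [u u0 <-] [v v0 <-]; exists (u ++ v); last exact: gwordM.
  by rewrite /= height_cat u0 v0.
by move=> _ [u u0 <-]; exists (winv u); rewrite ?gwordV //= heightV u0 oppr0.
Qed.

(** Such a commutator adds a multiple of [r] to [c]. Every element keeps [r] and changes [c] by an
    amount independent of [c], hence commutes with it. *)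
Lemma height0_comm_center x y : height0 x -> height0 y -> center_set [~ x, y]%g.
Proof.
move=> [u u0 <-] [v v0 <-] z; have [w ->] := gwordP z; rewrite -gword_comm.
apply: geltP => e c; rewrite !gfunM /=.
have [psi [L [k [LD uE]]]] := height0_transl (qfun (A e)) u0.
have [chi [M [l [MD vE]]]] := height0_transl (qfun (A e)) v0.
have cE := transl_comm (qfun0 _) LD MD uE vE.
have [xi [N [m [ND wE]]]] := wact_shape (qfun (A e)) w.
by rewrite !(cE, wE); apply: configP => [j||] //=; rewrite -!addbA addbCA addbC !addbA.
Qed.

(** Commutators have height 0, so the derived subgroup of the quotient lies in the image of
    [height0], whose commutators are central. *)
Lemma gelt_central_by_metabelian : central_by_metabelian (gelt A).
Proof.
rewrite /central_by_metabelian /metabelian; set G' := commutator_subgroup _ _ => a b.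
have G'P c : G' c -> exists2 x, height0 x & quot_pi (center (gelt A)) x = c.
  move=> /(_ [set quot_pi _ x | x in height0]); apply.
  split=> [|_ [a'] [b'] [_ _ ->]]; first exact/image_subgroup/height0_subgroup.
  rewrite -(quot_piK a') -(quot_piK b') -quot_piR; exists [~ repr a', repr b']%g => //.
  have [u ->] := gwordP (repr a'); have [v ->] := gwordP (repr b').
  by exists (wcomm u v); rewrite ?gword_comm //= height_comm.
move=> /G'P[x x0 <-] /G'P[y y0 <-]; apply/commgP/eqP; rewrite -quot_piR.
exact/quot_pi_eq1/height0_comm_center.
Qed.

End Metabelian.

(** * Iterated commutators and the elements z_k *)

Definition aword : word 2 := [:: (ord0, false)].
Definition tword m : word 2 := nseq m (ord_max, false).

(** The left-normed commutator of [a ^ (t ^ m)] with [j] copies of [t]. Thus [cword (2 ^ k) 0] below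
    is z_k. *)
Fixpoint deep m j : word 2 :=
  if j is j'.+1 then wcomm (deep m j') (tword 1)
  else winv (tword m) ++ aword ++ tword m.

Definition cword m j := wcomm (deep m j) aword.

Lemma wact_tword Q m v : wact Q (tword m) v = (fun j => v.1.1 (j + m%:Z)%R, v.1.2, v.2).
Proof.
elim: m v => [|m IHm] v; first by apply: configP => [j||] //=; rewrite addr0.
rewrite [LHS]IHm /lact /=; apply: configP => [j||] //=.
by congr (v.1.1 _); lia.
Qed.

Lemma wact_twordV Q m v : Q 0%R = false ->
  wact Q (winv (tword m)) v = (fun j => v.1.1 (j - m%:Z)%R, v.1.2, v.2).
Proof.
move=> Q0; apply: (can_inj (wactK Q0 (tword m))); rewrite wactVK // wact_tword.
by apply: configP => [j||] //=; rewrite addrK.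
Qed.

Lemma wact_aword Q v :
  wact Q aword v = transl Q (fun phi => phi 0%R) false v.
Proof. by apply: configP => [j||] //=; rewrite andbF addbF. Qed.

Lemma additive_dif j i : additive_form (fun phi => iter j dif phi i).
Proof. by move=> phi psi; rewrite iter_difD. Qed.

(** Each commutator with [t] applies [dif] both to the function added to [phi] and to the linear
    form, whose base point moves down by 1. *)
Lemma wact_deep (Q : int -> bool) m j : Q 0%R = false -> exists k, forall v,
  wact Q (deep m j) v = transl (iter j dif (fun i => Q (i + m%:Z)%R))
    (fun phi => iter j dif phi (- m%:Z - j%:Z)%R) k v.
Proof.
move=> Q0; elim: j => [|j [k kE]].
  exists false => v; rewrite -[deep m 0]/(winv (tword m) ++ aword ++ tword m).
  rewrite !wact_cat wact_twordV // wact_aword wact_tword.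
  apply: configP => [i||] //=.
    by congr (v.1.1 _ (+) _); rewrite addrK.
  by congr (_ (+) v.1.1 _ (+) _); lia.
set psi := iter j dif _ in kE.
exists (iter j dif psi (- m%:Z - j%:Z)%R (+) iter j dif psi (- m%:Z - j.+1%:Z)%R) => v.
rewrite -[deep m j.+1]/(wcomm (deep m j) (tword 1)) /wcomm !wact_cat.
rewrite (transl_winv Q0 (@additive_dif j _) kE) wact_twordV // kE.
rewrite wact_tword; apply: configP => [i||] //=.
  rewrite addrK /dif -/psi; move: (v.1.1 i) v.2 (psi i) (psi (i + 1)%R).
  by do 4!case.
have -> : (- m%:Z - j%:Z = - m%:Z - j.+1%:Z + 1)%R by lia.
rewrite iter_difD (additive_scale _ (fun i => psi (i - 1)%R) (@additive_dif j _)).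
rewrite !iter_dif_shift !addrK.
rewrite -[dif _ _]/(_ (+) _); move: (- m%:Z - j.+1%:Z)%R {kE} => i.
move: v.1.2 v.2 (iter j dif v.1.1 i) (iter j dif v.1.1 (i + 1)%R) (iter j dif psi i).
by move: (iter j dif psi (i + 1)%R) (k); do 7!case.
Qed.

Lemma wact_cword0 (A : nat -> bool) k v :
  wact (qfun A) (cword (2 ^ k) 0) v = (v.1.1, v.1.2 (+) (v.2 && A k), v.2).
Proof.
have [l dE] := wact_deep (2 ^ k) 0 (qfun0 A).
rewrite (transl_comm (qfun0 A) (@additive_dif 0 _) _ dE (@wact_aword _)) //=.
by rewrite subr0 add0r qfun_pow qfun_opp_pow.
Qed.

(** By Frobenius [dif ^ (2 ^ k)] is a two-point sum, so [Q] is evaluated at [2 ^ k], [2 ^ k.+1] and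
    their negatives; at the negatives it vanishes. *)
Lemma wact_cword_pow (A : nat -> bool) k v :
  wact (qfun A) (cword (2 ^ k) (2 ^ k)) v =
  (v.1.1, v.1.2 (+) (v.2 && (A k (+) A k.+1)), v.2).
Proof.
have [l dE] := wact_deep (2 ^ k) (2 ^ k) (qfun0 A).
rewrite (transl_comm (qfun0 A) (@additive_dif (2 ^ k) _) _ dE (@wact_aword _)) //=.
rewrite !iter_dif_pow add0r subrK qfun_opp_pow addbF qfun_pow.
have -> : (- (2 ^ k)%:Z - (2 ^ k)%:Z = - (2 ^ k.+1)%:Z)%R by rewrite expnS; lia.
have -> : ((2 ^ k)%:Z + (2 ^ k)%:Z = (2 ^ k.+1)%:Z)%R by rewrite expnS; lia.
by rewrite qfun_opp_pow qfun_pow.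
Qed.

Lemma deep_lcs A m j : lcs_set (gelt A) j.+1 (gword A (deep m j)).
Proof.
elim: j => [//|j IHj]; rewrite [deep _ _]/= gword_comm.
by apply: sub_gen_smallest; exists (gword A (deep m j)), (gword A (tword 1)).
Qed.

Lemma cword_lcs A m j : lcs_set (gelt A) j.+2 (gword A (cword m j)).
Proof.
rewrite gword_comm; apply: sub_gen_smallest.
by exists (gword A (deep m j)), (gword A aword); split=> //; apply: deep_lcs.
Qed.

Lemma lcs_leq (G : groupType) m n (x : G) : m <= n -> lcs_set G n x -> lcs_set G m x.
Proof.
suff lcsS k y : lcs_set G k.+1 y -> lcs_set G k y.
  by move/subnK <-; elim: (n - m) => // k IHk /lcsS.
case: k => [//|k] yk; apply: (yk (lcs_set G k.+1)); split=> [|_ [a] [b] [ak _ ->]].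
  exact: lcs_group.
have [_ lM lV] := lcs_group G k.+1.
by rewrite commgEl; apply: lM; [apply: lV | apply: (lcs_conj (n := k.+1))].
Qed.

(** * Residual nilpotence *)

(** This allows an arbitrary [phi] to be replaced by a periodic one agreeing with it near 0. *)
Lemma wact_local Q w : exists B : nat, forall u v : config,
  (forall i : int, (`|i| <= B)%N -> u.1.1 i = v.1.1 i) ->
  u.1.2 = v.1.2 -> u.2 = v.2 -> (wact Q w u).1.2 = (wact Q w v).1.2.
Proof.
elim: w => [|[i b] w [B IHB]]; first by exists 0.
exists B.+1 => u v uv uv1 uv2; apply: IHB => [j jB||]; rewrite /lact /=; case: ifP => _ //=.
- by rewrite uv2 uv //; lia.
- by apply: uv; case: (b); lia.
- by rewrite uv1 uv.
Qed.

Section Residual.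
Variable A : nat -> nat -> bool.
Hypothesis Afin : forall e, exists K, forall k, A e k -> k < K.

Lemma qfun_dif e : exists K, forall K', K <= K' ->
  iter (2 ^ K') dif (qfun (A e)) = fun=> false.
Proof.
have [K AK] := Afin e; exists K.+1 => -[//|K'] leK; rewrite iter_dif_pow.
apply/funext => j; rewrite -[((2 ^ K'.+1)%:Z)%R]mul1r (@qfun_periodic _ K') ?addbb // => k /AK.
by move/leq_trans; apply.
Qed.

Lemma periodic_fix (x : gelt A) :
  (forall e, exists K, forall K', K <= K' -> forall v : config,
     iter (2 ^ K') dif v.1.1 = (fun=> false) -> x e v = v) -> x = 1%g.
Proof.
move=> fixx; apply: geltP => e v; have {fixx} [K fixK] := fixx e.
have [w xw] := gwordP x; rewrite xw in fixK *; rewrite /= in fixK *.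
have [psi [L [k [_ wE]]]] := wact_shape (qfun (A e)) w.
have [B BP] := wact_local (qfun (A e)) w.
suff approx N : exists u : config, [/\ wact (qfun (A e)) w u = u, u.1.2 = v.1.2,
    u.2 = v.2 & forall i : int, (`|i| <= N)%N -> u.1.1 i = v.1.1 i].
  apply: configP => [j||]; last by rewrite wE.
    have [u [ux _ u2 uv]] := approx (absz j + absz (j + height w)%R).
    have := congr1 (fun u' : config => u'.1.1 j) ux; rewrite /= !wE /= u2.
    by rewrite !uv //; lia.
  have [u [ux u1 u2 uv]] := approx B.
  by rewrite -(BP u v uv u1 u2) ux.
pose P := 2 ^ (K + N.*2.+1).
have NP : N.*2 < P.
  apply: leq_trans (ltn_expl _ (ltnSn 1)) _; rewrite leq_exp2l //; lia.
(* The restriction of [phi] to the interval from [-N] to [P - N - 1], repeated with period [P]; it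
   contains [[-N, N]] since [2 N < P]. *)
exists (fun i : int => v.1.1 (modz (i + N%:Z) P%:Z - N%:Z)%R, v.1.2, v.2); split=> //=.
  apply: (fixK (K + N.*2.+1)); first exact: leq_addr.
  rewrite iter_dif_pow; apply/funext => j /=.
  by rewrite -/P [(j + P%:Z + _)%R]addrAC modzDr addbb.
move=> i iN; congr (v.1.1 _); rewrite modz_small ?addrK //; lia.
Qed.

Lemma gelt_residually_nilpotent : residually_nilpotent (gelt A).
Proof.
move=> x x1; apply: contrapT => noN; apply/x1/periodic_fix => e.
have [K QK] := qfun_dif e; exists K => K' leK v v0; apply: contrapT => xv.
apply: noN; set d := 2 ^ K'; have Qd := QK _ leK; rewrite -/d in Qd v0.
(* The kernel of the action at [e] on [chain d d.+2]. It misses [x], which moves [v], and by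
   [lcs_stab] it contains the term [d.+2] of the lower central series. *)
pose S := [set y : gelt A | forall u, chain d d.+2 u -> y e u = u].
have Sgroup : subgroup S.
  split=> [u _ //|y z Sy Sz u du|y Sy u du]; first by rewrite gfunM Sy ?Sz.
  by rewrite -{1}(Sy u du) gfunK.
have Sconj (y z : gelt A) : S y -> S (y ^ z)%g.
  move=> Sy u du; rewrite /conjg !gfunM Sy ?gfunVK //.
  exact: stab_chain (gfun_stab Qd _) du.
exists (NormalSubgroup Sgroup Sconj); split=> [Sx|].
  by apply: xv; apply: Sx; apply: chain_top.
exists d.+2; apply/seteqP; split=> [a /lcs_quot[y yd ->]|a ->]; last first.
  by have [] := lcs_group (quot (NormalSubgroup Sgroup Sconj)) d.+2.
apply/quot_pi_eq1 => u du /=.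
rewrite -[RHS](vaddK _ (y e u)) vaddC [vadd u _]vaddC.
by rewrite (lcs_stab Qd yd (i := 0)) ?vadd0.
Qed.

End Residual.

(** * Correctness of the word test *)

Definition xsum (F : nat -> bool) (l : seq nat) : bool := \big[addb/false]_(x <- l) F x.

Lemma xsum_cons F x l : xsum F (x :: l) = F x (+) xsum F l.
Proof. exact: big_cons. Qed.

Lemma odd_foldl (F : nat -> bool) q l :
  odd (foldl (fun n x => n + F x) q l) = odd q (+) xsum F l.
Proof.
elim: l q => [|x l IHl] q; first by rewrite /xsum big_nil addbF.
by rewrite [foldl _ _ _]/= IHl xsum_cons oddD oddb addbA.
Qed.

(** Grouped by residue modulo [M], the sum has an even number of equal terms in each class. *)
Lemma xsum_periodic M F l : 0 < M ->
  (forall i, i < M -> xsum (fun x => x %% M == i) l = false) ->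
  (forall x, x \in l -> F x = F (x %% M)) -> xsum F l = false.
Proof.
move=> M0 l0 FM.
have -> : xsum F l = \big[addb/false]_(x <- l) \big[addb/false]_(i < M) (F i && (x %% M == i)).
  apply: eq_big_seq => x xl; rewrite (bigD1 (Ordinal (ltn_pmod x M0))) //.
  rewrite [nat_of_ord _]/= eqxx andbT big1 /= ?addbF -?FM // => i.
  by rewrite -val_eqE /= eq_sym => /negbTE->; rewrite andbF.
rewrite exchange_big big1 // => i _.
by case: (F i) => /=; [apply: l0 | rewrite big1].
Qed.

(** The effect on [c], for [r = 1], of the translates of [Q] that earlier letters [a] have added to
    [phi]. *)
Fixpoint psum (Q : int -> bool) (l : seq nat) : bool :=
  if l is h :: l' then xsum (fun x => Q (h%:Z - x%:Z)%R) l' (+) psum Q l' else false.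

Definition letters (w : word 2) : seq nat := [seq (a.1 : nat).*2 + a.2 | a : 'I_2 * bool <- w].

(* The final height and the heights at which [a] occurs, the latest first. *)
Fixpoint track (h : nat) (l : seq nat) (w : word 2) : nat * seq nat :=
  if w is (i, b) :: w' then
    if i == ord0 then track h (h :: l) w'
    else track (if b then h.-1 else h.+1) l w'
  else (h, l).

Lemma ord2P (i : 'I_2) : i = ord0 \/ i = ord_max.
Proof. by case: i => [[|[|//]] ilt]; [left|right]; apply: val_inj. Qed.

Lemma hstep_track A h l q w :
  exists2 q', foldl (hstep A) (cpair h (cpair (encode_seq l) q)) (letters w) =
      cpair (track h l w).1 (cpair (encode_seq (track h l w).2) q')
    & odd q' (+) psum (qfun A) (track h l w).2 = odd q (+) psum (qfun A) l.
Proof.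
elim: w h l q => [|[i b] w IHw] h l q; first by exists q.
have [->|->] := ord2P i.
  have -> : foldl (hstep A) (cpair h (cpair (encode_seq l) q)) (letters ((ord0, b) :: w)) =
    foldl (hstep A) (cpair h (cpair (encode_seq (h :: l))
      (foldl (fun n x => n + qnat A h x) q l))) (letters w).
    rewrite [letters _]/= [foldl _ _ (_ :: _)]/= {2}/hstep.
    by rewrite !cpK encodeK; case: b.
  have [q' -> qE] := IHw h (h :: l) (foldl (fun n x => n + qnat A h x) q l).
  exists q' => //; rewrite [track _ _ _]/= qE odd_foldl /= -addbA; congr (_ (+) _).
  rewrite addbA; have -> : xsum (qnat A h) l = xsum (fun x => qfun A (h%:Z - x%:Z)%R) l.
    by apply: eq_bigr => x _; rewrite qnatE.
  by rewrite addbb.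
have -> : foldl (hstep A) (cpair h (cpair (encode_seq l) q)) (letters ((ord_max, b) :: w)) =
  foldl (hstep A) (cpair (if b then h.-1 else h.+1) (cpair (encode_seq l) q)) (letters w).
  rewrite [letters _]/= [foldl _ _ (_ :: _)]/= {2}/hstep.
  by rewrite !cpK; case: b.
exact: IHw.
Qed.

(** The image of [v] under a word that starts at height [h0], ends at [h] and has its letters [a] at
    the heights [l]. *)
Definition tracked Q h0 (v : config) h l : config :=
  (fun j => v.1.1 (j + h%:Z - h0%:Z)%R (+) (v.2 && xsum (fun x => Q (j + h%:Z - x%:Z)%R) l),
   v.1.2 (+) xsum (fun x => v.1.1 (x%:Z - h0%:Z)%R) l (+) (v.2 && psum Q l), v.2).

(** Starting no lower than the length of the word keeps [h.-1] from truncating at 0. *)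
Lemma wact_track Q h0 v h l w : size w <= h ->
  wact Q w (tracked Q h0 v h l) = tracked Q h0 v (track h l w).1 (track h l w).2.
Proof.
elim: w h l => [//|[i b] w IHw] h l /= wh.
have [->|->] := ord2P i; last first.
  rewrite -IHw; last by case: b; lia.
  congr (foldl _ _ w); rewrite /lact /=; apply: configP => [j||] //=.
  congr (v.1.1 _ (+) (_ && _)); first by case: b; lia.
  by apply: eq_bigr => x _; congr Q; case: b; lia.
rewrite -IHw; last by lia.
congr (foldl _ _ w); rewrite /lact /=; apply: configP => [j||] //=.
  rewrite -addbA -andb_addr xsum_cons addbC [_ (+) Q _]addbC addrK.
  by rewrite addbC.
rewrite !xsum_cons add0r.
clear wh IHw; move: (v.1.2) (v.1.1 _) (v.2) (psum _ _).
by move: (xsum _ _) (xsum _ _); do 6!case.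
Qed.

Definition pos w := track (size w) [::] w.

Lemma wact_pos Q w v : wact Q w v = tracked Q (size w) v (pos w).1 (pos w).2.
Proof.
rewrite -(wact_track Q (size w) v [::] (leqnn (size w))); congr wact.
apply: configP => [j||] //=; last by rewrite /xsum big_nil andbF !addbF.
by rewrite addrK /xsum big_nil andbF addbF.
Qed.

Lemma track_bound B h l w : h + size w <= B -> all (geq B) l ->
  all (geq B) ((track h l w).1 :: (track h l w).2).
Proof.
elim: w h l => [|[i b] w IHw] h l hB lB.
  by rewrite /= lB andbT; rewrite addn0 in hB.
rewrite /= in hB; have [->|->] := ord2P i; apply: IHw => //; try lia.
  by rewrite /= lB andbT; lia.
by case: b; lia.
Qed.

Lemma htestE A M w : htest A M (letters w) =
  [&& (pos w).1 %% M == size w %% M,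
      all (fun i => ~~ xsum (fun x => x %% M == i) (pos w).2) (iota 0 M)
    & ~~ psum (qfun A) (pos w).2].
Proof.
have sw : size (letters w) = size w by rewrite size_map.
rewrite /htest /hrun sw -[0]/(encode_seq [::]).
have [q -> qE] := hstep_track A (size w) [::] 0 w; rewrite !cpK encodeK.
rewrite -/(pos w) in qE *; congr [&& _, _ & ~~ _].
  by apply: eq_all => i /=; rewrite odd_foldl.
by move: qE => /=; case: (odd q); case: (psum _ _).
Qed.

Definition periodic (M : nat) (phi : int -> bool) :=
  forall i j : int, phi (i + j * M%:Z)%R = phi i.

Lemma htest_fix A M w v : 0 < M -> periodic M (qfun A) -> periodic M v.1.1 ->
  htest A M (letters w) -> wact (qfun A) w v = v.
Proof.
move=> M0 QM vM; rewrite htestE => /and3P[hM /allP lM /negbTE pM].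
have l0 F : (forall x : nat, F x = F (x %% M)) -> xsum F (pos w).2 = false.
  move=> FM; apply: (xsum_periodic M0) => // i iM; apply/negbTE/lM.
  by rewrite mem_iota.
have modM (x : nat) : (x%:Z = (x %% M)%N%:Z + (x %/ M)%N%:Z * M%:Z)%R.
  by rewrite {1}(divn_eq x M) addrC; lia.
rewrite wact_pos; apply: configP => [j||] //=.
  rewrite l0 ?andbF ?addbF => [|x].
    move: hM; rewrite eqn_mod_int => /asboolP[k ->].
    by rewrite -[RHS](vM j k); congr (v.1.1 _); lia.
  rewrite {1}(modM x) -(QM _ ((x %/ M)%:Z)%R); congr (qfun A _); lia.
rewrite pM andbF addbF l0 ?addbF // => x.
by rewrite {1}(modM x) addrAC vM.
Qed.

Lemma periodic_mod M (B : int -> bool) :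
  periodic M (fun j => B (modz j (M%:Z)%R)).
Proof. by move=> i j; rewrite addrC modzMDl. Qed.

(** Three kinds of test vectors: the indicator of the multiples of [M] detects the shift, that of a
    residue class the parity of its occurrences, and [(0, 0, 1)] the constant. *)
Lemma fix_htest A M w : 0 < M ->
  (forall v : config, periodic M v.1.1 -> wact (qfun A) w v = v) ->
  htest A M (letters w).
Proof.
move=> M0 fixw; rewrite htestE; apply/and3P; split.
- have := fixw (fun j => modz j (M%:Z)%R == 0%R, false, false) (periodic_mod _ (eq_op^~ 0%R)).
  rewrite wact_pos => /(congr1 (fun v : config => v.1.1 0%R)) /=.
  rewrite addbF add0r mod0z eqxx => /eqP hM.
  rewrite eqn_mod_int; apply/asboolP; exists (divz ((pos w).1%:Z - (size w)%:Z)%R (M%:Z)%R).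
  have := divz_eq ((pos w).1%:Z - (size w)%:Z)%R (M%:Z)%R; rewrite hM; lia.
- apply/allP => i; rewrite mem_iota /= add0n => iM; apply/negP => xs.
  have per : periodic M (fun j => modz (j + (size w)%:Z)%R (M%:Z)%R == (i%:Z)%R).
    move=> j k; have -> : (j + k * M%:Z + (size w)%:Z = k * M%:Z + (j + (size w)%:Z))%R by lia.
    by rewrite modzMDl.
  have := fixw (_, false, false) per; rewrite wact_pos => /(congr1 (fun v : config => v.1.2)) /=.
  suff -> : xsum (fun x => modz (x%:Z - (size w)%:Z + (size w)%:Z)%R (M%:Z)%R ==
      (i%:Z)%R) (pos w).2 =
    xsum (fun x => x %% M == i) (pos w).2 by rewrite xs.
  by apply: eq_bigr => x _; rewrite subrK modz_nat eqz_nat.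
have per : periodic M (fun=> false) by [].
have := fixw (_, false, true) per; rewrite wact_pos => /(congr1 (fun v : config => v.1.2)) /=.
by rewrite /xsum big1 //= => ->.
Qed.

Section WordProblem.
Variable A : nat -> nat -> bool.
Hypothesis A_geq : forall e k, A e k -> 4 * e <= k.

Lemma gword_eq1 w : gword A w = 1%g <->
  all (fun e => htest (A e) (size w).*2.+1 (letters w)) (iota 0 (size w).+1).
Proof.
set M := (size w).*2.+1; split=> [w1|/allP testw].
  apply/allP => e _; apply: fix_htest => // v _.
  by rewrite -[LHS]/(gword A w e v) w1.
have test e : e <= size w -> htest (A e) M (letters w).
  by move=> ew; apply: testw; rewrite mem_iota.
have := test 0 (leq0n _); rewrite htestE => /and3P[hM /allP lM _].
have /andP[hB /allP lB] : all (geq (size w).*2) ((pos w).1 :: (pos w).2).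
  by apply: track_bound; rewrite // addnn.
have hE : (pos w).1 = size w.
  by move: hM; rewrite !modn_small ?ltnS // => [/eqP|]; rewrite // -addnn leq_addr.
have l0 F : xsum F (pos w).2 = false.
  apply: (@xsum_periodic M) => // [i iM|x /lB xB]; last by rewrite modn_small.
  by apply/negbTE/lM; rewrite mem_iota.
apply: geltP => e v; rewrite /= wact_pos hE.
apply: configP => [j||] //=; first by rewrite addrK l0 andbF addbF.
rewrite l0 addbF; suff -> : psum (qfun (A e)) (pos w).2 = false by rewrite andbF addbF.
(* For [e > size w] all differences of heights are below [2 ^ (4 * e)], where [qfun (A e)]
   vanishes. *)
have [/test|ew] := leqP e (size w); first by rewrite htestE => /and3P[_ _ /negbTE].
have {lB} : all (geq (size w).*2) (pos w).2 by apply/allP.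
elim: (pos w).2 => // x l IHl /= /andP[xB lB]; rewrite IHl // addbF.
rewrite /xsum big_seq big1 // => y yl; apply: (@qfun_small _ (4 * e)) => [k /A_geq//|].
have yB := allP lB y yl; have eP := ltn_expl (4 * e) (ltnSn 1).
by apply: leq_ltn_trans eP; move: xB yB => /=; lia.
Qed.

End WordProblem.

(** * The diagonal argument *)

Definition final st := (cfst st == 1) && (csnd (csnd st) == 0).

(** The step after a final state is dead, and dead states stay dead. *)
Lemma final_inj e s s' : final (conf e s) -> final (conf e s') -> s = s'.
Proof.
suff mono t t' : final (conf e t) -> final (conf e t') -> t <= t'.
  by move=> fs fs'; apply/eqP; rewrite eqn_leq !mono.
move=> ft /andP[/eqP m1 /eqP k0]; rewrite leqNgt; apply/negP => lt.
have dead d : cfst (conf e (d + t'.+1)) = 0.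
  elim: d => [|d IHd]; last by rewrite addSn /conf iterS -/(conf _ _) /mstep IHd eqxx.
  by rewrite add0n /conf iterS -/(conf _ _) /mstep m1 k0 /= cfstK.
by have /andP[/eqP] := ft; rewrite -(subnK lt) dead.
Qed.

Lemma halts_atE e s :
  halts_at e s = final (conf e s) && passes e (cfst (csnd (conf e s))).
Proof. by rewrite /halts_at andbA. Qed.

Lemma halts_at_inj e s s' : halts_at e s -> halts_at e s' -> s = s'.
Proof. by rewrite !halts_atE => /andP[fs _] /andP[fs' _]; apply: final_inj fs fs'. Qed.

Lemma index_set_geq e k : index_set e k -> 4 * e <= k.
Proof.
case/orP => [/eqP-> //|/hasP[s _ /andP[/eqP-> _]]].
by have := leq_cpair e s; lia.
Qed.

Lemma index_set_finite e : exists K, forall k, index_set e k -> k < K.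
Proof.
have [[s hs]|nh] := pselect (exists s, halts_at e s).
  exists (4 * e + 4 * cpair e s + 3) => k /orP[/eqP->|]; first by lia.
  case/hasP => s' _ /andP[/eqP-> hs']; rewrite (halts_at_inj hs' hs); lia.
exists (4 * e).+1 => k /orP[/eqP-> //|/hasP[s _ /andP[_ hs]]].
by case: nh; exists s.
Qed.

Lemma index_set_even e k : index_set e k -> odd k = false.
Proof.
by case/orP => [/eqP->|/hasP[s _ /andP[/eqP-> _]]]; [rewrite oddM | rewrite oddD oddM].
Qed.

Lemma index_set_base e e' : index_set e' (4 * e) = (e' == e).
Proof.
apply/idP/eqP => [/orP[/eqP|/hasP[s _ /andP[/eqP]]]|->]; try lia.
by rewrite /index_set eqxx.
Qed.

(** With [index_set_base] this shows that [4 * e] and [4 * cpair e s + 2] belong to the same sets,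
    so that their z_k coincide. *)
Lemma index_set_halt e s e' : halts_at e s ->
  index_set e' (4 * cpair e s + 2) = (e' == e).
Proof.
move=> hs; apply/idP/eqP => [/orP[/eqP|/hasP[s' _ /andP[/eqP ss' _]]]|->]; first by lia.
  have /(congr1 cfst) : cpair e s = cpair e' s' by lia.
  by rewrite !cfstK.
apply/orP; right; apply/hasP; exists s; rewrite ?eqxx // mem_iota add0n.
by have := leq_cpair e s; lia.
Qed.

Lemma index_setN e k : (forall s, ~~ halts_at e s) -> index_set e k = base_set e k.
Proof.
move=> nh; rewrite /index_set; case: (k == _) / eqP => //= [->|/eqP/negbTE ke].
  by rewrite /base_set eqxx.
by rewrite /base_set ke; apply/hasP => -[s _ /andP[_]]; apply/negP.
Qed.

Lemma cword_halt e s : halts_at e s ->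
  lcs_set (gelt index_set) (period e).+2 (gword index_set (cword (2 ^ (4 * e)) 0)).
Proof.
move=> hs; set k := 4 * cpair e s + 2.
have -> : gword index_set (cword (2 ^ (4 * e)) 0) = gword index_set (cword (2 ^ k) (2 ^ k)).
  apply: geltP => e' v /=; rewrite wact_cword0 wact_cword_pow index_set_base index_set_halt //.
  suff -> : index_set e' k.+1 = false by rewrite addbF.
  by apply/negP => /index_set_even; rewrite /= /k oddD oddM.
apply: lcs_leq _ (@cword_lcs _ _ (2 ^ k)); rewrite !ltnS leq_exp2l // /k.
by have := leq_cpair e s; lia.
Qed.

(** * Relators and their action on periodic vectors *)

Lemma iter_dif_periodic k phi :
  iter (2 ^ k) dif phi = (fun=> false) <-> periodic (2 ^ k) phi.
Proof.
rewrite iter_dif_pow; split=> [phi0 i j|phiP]; last first.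
  by apply/funext => j; rewrite -[((2 ^ k)%:Z)%R]mul1r phiP addbb.
have step x : phi (x + (2 ^ k)%:Z)%R = phi x.
  by have /= := congr1 (@^~ x) phi0; case: (phi x); case: (phi _).
have pos (n : nat) x : phi (x + n%:Z * (2 ^ k)%:Z)%R = phi x.
  elim: n => [|n IHn]; first by rewrite mul0r addr0.
  by rewrite -IHn -[RHS]step; congr phi; lia.
case: j => n; first exact: pos.
by rewrite -(pos n.+1 (i + _)%R); congr phi; lia.
Qed.

Lemma base_periodic e : periodic (period e) (qfun (base_set e)).
Proof.
have bP k : base_set e k -> k < (4 * e).+1 by move/eqP->.
by move=> i j; rewrite /period addn2; apply: (qfun_periodic bP).
Qed.

Lemma word_value_quot (G : groupType) (N : normalSubgroup G) k (g : k.-tuple G) w :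
  word_value [tuple of map (quot_pi N) g] w = quot_pi N (word_value g w).
Proof.
rewrite /word_value; elim: w => [|a w IHw]; rewrite ?big_nil // !big_cons IHw quot_piM.
by congr (_ * _)%g; rewrite tnth_map; case: a.2; rewrite ?quot_piV.
Qed.

Lemma pres_eq_base e R u v :
  (forall r, r \in R -> htest (base_set e) (period e) (letters r)) ->
  pres_eq R u v -> forall x : config, periodic (period e) x.1.1 ->
  wact (qfun (base_set e)) u x = wact (qfun (base_set e)) v x.
Proof.
set Q := qfun _ => testR; elim=> {u v} //.
- by move=> u v _ IH x xP; rewrite IH.
- by move=> u v w _ IHu _ IHv x xP; rewrite IHu ?IHv.
- move=> u u' v v' _ IHu _ IHv x xP; rewrite !wact_cat IHu // IHv //.
  have [psi [L [k [_ wE]]]] := wact_shape Q u'.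
  (* The hypothesis on [v] is applied at [wact Q u' x], which is again periodic because words
     preserve the chain. *)
  have Qd : iter (period e) dif Q = fun=> false by apply/iter_dif_periodic/base_periodic.
  have /iter_dif_periodic/(@chain_top (period e) x) xc := xP.
  have /= [] := stab_chain (wact_stab Qd u') xc.
  have -> : minn (period e).+1 (period e) = period e by lia.
  by move/iter_dif_periodic.
- by move=> i b x _; apply: (lactK (qfun0 _)).
- move=> r rR x xP; apply: (@htest_fix _ (period e)); rewrite ?expn_gt0 //.
    exact: base_periodic.
  exact: testR.
Qed.

Lemma passes_words e R :
  passes e (encode_words R) = all (fun r => htest (base_set e) (period e) (letters r)) R.
Proof.
rewrite /passes /encode_words encodeK all_map; apply: eq_all => r /=.
by rewrite /encode_word encodeK.
Qed.

Lemma no_computable_quotients : ~ computable_nilpotent_quotients (gens index_set).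
Proof.
move=> [c cP]; pose e := pcode c; set H := gelt index_set in cP.
have [R Rc [_ Rpres]] := cP (period e).+2 isT.
have presE w : pres_eq R w [::] <-> lcs_set H (period e).+2 (gword index_set w).
  rewrite Rpres !word_value_quot !word_value_gens.
  exact: (quot_pi_eq1 (lcs H (period e).+2) (gword index_set w)).
have [s sR] := machine_complete 0 Rc.
have halts_sE : halts_at e s = passes e (encode_words R).
  by rewrite halts_atE /final /conf sR !cpK.
(* If the relators pass, z_(4e) lies in the term n_e and follows from them, yet it moves
   [(0, 0, 1)], as [4 * e] is in [base_set e]. *)
have [pR|npR] := boolP (passes e (encode_words R)).
  have W0 : pres_eq R (cword (2 ^ (4 * e)) 0) [::].
    by apply/presE; apply: (@cword_halt e s); rewrite halts_sE.
  rewrite passes_words in pR; have testR r rR := allP pR r rR.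
  have := pres_eq_base testR W0 (x := (fun=> false, false, true)) (fun _ _ => erefl).
  by rewrite wact_cword0 => /(congr1 (fun v : config => v.1.2)) /=; rewrite /base_set eqxx.
(* If they fail, [index_set e] is [base_set e]. The periodic action then factors through the
   quotient, so the relators pass after all. *)
have nh t : ~~ halts_at e t.
  apply: contraNN npR => ht; rewrite -halts_sE (@final_inj e s t) //.
    by rewrite /final /conf sR !cpK.
  by move: ht; rewrite halts_atE => /andP[].
case/negP: npR; rewrite passes_words; apply/allP => r rR.
have baseE : index_set e = base_set e by apply/funext => k; apply: index_setN.
apply: fix_htest => [|v vP]; first by rewrite expn_gt0.
rewrite -baseE -[LHS]/(gword index_set r e v); apply: (@lcs_fix _ _ (period e)).
- by rewrite baseE; apply/iter_dif_periodic/base_periodic.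
- by apply/presE/pres_relator.
- exact/iter_dif_periodic.
Qed.

Theorem theorem69 :
  exists (H : groupType) (k : nat) (g : k.-tuple H),
    [/\ generates g,
        residually_nilpotent H,
        solvable_word_problem g,
        ~ computable_nilpotent_quotients g
      & central_by_metabelian H].
Proof.
exists (gelt index_set), 2, (gens index_set); split.
- exact: gens_generate.
- exact/gelt_residually_nilpotent/index_set_finite.
- have [c cP] := comp_trivial_test; exists c => w.
  have := cP (encode_word w); rewrite /encode_word encodeK word_value_gens.
  suff -> : trivial_test [seq (a.1 : nat).*2 + a.2 | a : 'I_2 * bool <- w] =
    (gword index_set w == 1%g) by [].
  rewrite /trivial_test size_map; apply/idP/eqP => /(gword_eq1 index_set_geq w) //.
- exact: no_computable_quotients.
- exact: gelt_central_by_metabelian.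
Qed.
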